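(* Let $p$ be an odd prime. Every $p$-Coxeter subgroup that is not virtually abelian surjects onto uncountably many infinite residually finite $p$-groups.
   Context: A Coxeter group is a group with presentation $C=\langle x_1,\ldots,x_n \mid x_1^2,\ldots,x_n^2,\ (x_ix_j)^{m_{ij}},\ 1\le i<j\le n\rangle$, where each label $m_{ij}$ is an integer at least $2$ or $\infty$ ($m_{ij}=\infty$ means that the relator $(x_ix_j)^{m_{ij}}$ is not present). For $p$ an odd prime and $n\ge 2$, suppose that $C$ is a Coxeter group all of whose labels $m_{ij}$ are powers of $p$ or $\infty$. The corresponding $p$-Coxeter subgroup is the index 2 subgroup of $C$ given by the kernel of the homomorphism $\theta:C\to C_2$ (with $C_2$ the cyclic group of order 2) sending each $x_i$ to the generator. It has the presentation $\langle a_1,\ldots,a_{n-1}\mid a_1^{m_{12}},\ldots,a_{n-1}^{m_{1n}},\ (a_{i-1}a_{j-1}^{-1})^{m_{ij}}\ (2\le i<j\le n)\rangle$, where relators with infinite exponent are omitted. A (possibly infinite) group is a $p$-group if every element has order a power of $p$. Groups are counted up to isomorphism. *)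

(* Defs.v *)
From HB Require Import structures.
From mathcomp Require Import all_boot all_order all_algebra all_fingroup.
From mathcomp Require Import boolp classical_sets functions cardinality.

Set Implicit Arguments.
Unset Strict Implicit.
Unset Printing Implicit Defensive.

Local Open Scope group_scope.

(* The letter (i, false) stands for the generator x_i, and (i, true) for its
   formal inverse. *)
Definition word (I : Type) := seq (I * bool).

Definition gen_word (I : Type) (i : I) : word I := [:: (i, false)].

Definition inv_letter (I : Type) (a : I * bool) : I * bool := (a.1, ~~ a.2).

Definition inv_word (I : Type) (w : word I) : word I := rev (map (@inv_letter I) w).

Definition exp_word (I : Type) (w : word I) (k : nat) : word I :=
  flatten (nseq k w).

Definition eval_letter (G : groupType) (I : Type) (x : I -> G) (a : I * bool) : G :=
  if a.2 then (x a.1)^-1 else x a.1.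

Definition eval_word (G : groupType) (I : Type) (x : I -> G) (w : word I) : G :=
  foldr (fun a g => eval_letter x a * g) 1 w.

(* Elements of the free group on I are represented by not necessarily reduced
   words: normal_closure R w says that the class of w in the free group lies
   in the normal subgroup generated by the classes of the words in R.  The
   last two constructors make this independent of the representative. *)
Inductive normal_closure (I : Type) (R : word I -> Prop) : word I -> Prop :=
| nc_relator r : R r -> normal_closure R r
| nc_one : normal_closure R [::]
| nc_mul u v :
    normal_closure R u -> normal_closure R v -> normal_closure R (u ++ v)
| nc_inv u : normal_closure R u -> normal_closure R (inv_word u)
| nc_conj u v :
    normal_closure R v -> normal_closure R (inv_word u ++ v ++ u)
| nc_insert u a v :
    normal_closure R (u ++ v) -> normal_closure R (u ++ a :: inv_letter a :: v)
| nc_delete u a v :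
    normal_closure R (u ++ a :: inv_letter a :: v) -> normal_closure R (u ++ v).

(* G = < x_i, i in I | R >: the map from the free group on I to G sending the
   i-th generator to x_i is onto, with kernel the normal closure of R. *)
Definition presented_by (G : groupType) (I : Type) (x : I -> G)
    (R : word I -> Prop) : Prop :=
  (forall g : G, exists w : word I, eval_word x w = g) /\
  (forall w : word I, eval_word x w = 1 <-> normal_closure R w).

(* Labels are given by m i j for i < j only; None is the label infinity, and
   the values of m elsewhere are irrelevant. *)
Inductive coxeter_relator (n : nat) (m : 'I_n -> 'I_n -> option nat) :
    word 'I_n -> Prop :=
| coxeter_square (i : 'I_n) : coxeter_relator m (exp_word (gen_word i) 2)
| coxeter_braid (i j : 'I_n) (k : nat) : (i < j)%N -> m i j = Some k ->
    coxeter_relator m (exp_word (gen_word i ++ gen_word j) k).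

Definition coxeter_group (n : nat) (m : 'I_n -> 'I_n -> option nat)
    (C : groupType) (x : 'I_n -> C) : Prop :=
  (forall (i j : 'I_n) (k : nat), (i < j)%N -> m i j = Some k -> (2 <= k)%N) /\
  presented_by x (coxeter_relator m).

Definition labels_powers_of (p n : nat) (m : 'I_n -> 'I_n -> option nat) : Prop :=
  forall (i j : 'I_n) (k : nat), (i < j)%N -> m i j = Some k ->
    exists e : nat, k = (p ^ e)%N.

Section Kernel.
Variables (G H : groupType) (f : {multiplicative G -> H}).

Definition kernel : {pred G} := [pred g | f g == 1].

Lemma kernel_group_closed : group_closed kernel.
Proof.
have f1 : f 1 = 1 by apply: (mulgI (f 1)); rewrite -gmulfM !mulg1.
have fV g : f g^-1 = (f g)^-1.
  by apply: (mulgI (f g)); rewrite -gmulfM !mulgV.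
split; first by rewrite inE f1.
move=> u v; rewrite !inE => /eqP fu /eqP fv.
by rewrite gmulfM fV fu fv mulgV.
Qed.

Definition kernel_group := {g : G | g \in kernel}.

HB.instance Definition _ := SubChoice.on kernel_group.
HB.instance Definition _ :=
  SubChoice_isSubGroup.Build G kernel kernel_group kernel_group_closed.

End Kernel.

Definition finite_index (G : groupType) (A : {pred G}) : Prop :=
  exists s : seq G, forall g : G, exists2 t : G, t \in s & t^-1 * g \in A.

Definition virtually_abelian (G : groupType) : Prop :=
  exists A : {pred G},
    [/\ group_closed A, {in A &, commutative *%g} & finite_index A].

Definition surjects_onto (G H : groupType) : Prop :=
  exists f : {multiplicative G -> H}, forall h : H, exists g : G, f g = h.

Definition isomorphic (G H : groupType) : Prop :=
  exists f : {multiplicative G -> H}, bijective f.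

Definition infinite_group (G : groupType) : Prop := infinite_set [set: G]%classic.

Definition residually_finite (G : groupType) : Prop :=
  forall g : G, g != 1 ->
    exists (F : finGroupType) (f : {multiplicative G -> F}), f g != 1.

Definition has_order (G : groupType) (g : G) (d : nat) : Prop :=
  [/\ (0 < d)%N, g ^+ d = 1 & forall k, (0 < k < d)%N -> g ^+ k <> 1].

Definition p_group (p : nat) (G : groupType) : Prop :=
  forall g : G, exists e : nat, has_order g (p ^ e)%N.

(* "Uncountably many groups with property P, up to isomorphism". *)
Definition uncountably_many_groups (P : groupType -> Prop) : Prop :=
  exists (I : Type) (Q : I -> groupType),
    [/\ ~ countable [set: I]%classic,
        forall i, P (Q i)
      & forall i j, i <> j -> ~ isomorphic (Q i) (Q j)].

(* Main.v *)
(* Write A = ker theta.  Suppose B is a finite group mapping onto C_2 with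
   p-torsion kernel, and each x_i is sent to (f_i, beta_i) in the wreath product
   of P by B, where f_i : B -> P is given by words in a marking of P.  If the
   Coxeter relations hold for all marked groups P satisfying finitely many
   relators w ^ (p ^ k), then each infinite residually finite p-group P of this
   kind produces such a quotient of A.

   - For p >= 5, and for p = 3 with n = 3 and a label other than 3, take B = C_2
     and x_i |-> (y_i, y_i^-1) with y running through 1, a, b; the relators say
     that a, b and a b^-1 have orders dividing p, p, p, respectively 3, 3, 9.
   - For p = 3 and n >= 4, reduce to the Coxeter group of the ideal regular
     tetrahedron, with B = (Z/3)^3 : 2; recording the crossings of two disjoint
     totally geodesic walls in the corresponding cover gives f_i with values in
     a free group of rank 2, without relators.
   - The remaining groups have abelian kernel (n = 2) or are Euclidean.

   The groups P are limits of finite p-groups, built as in Osin and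
   Schlage-Puchta.  Let Q be a finite p-group marked by X in which every relator
   w ^ (p ^ k) has w of order exactly p ^ k.  Integer weights on the edges of the
   Cayley graph of Q that vanish on all closed paths w ^ (p ^ k) form a space
   of dimension at least |Q| (|X| - sum p ^ -k).  If sum p ^ -k < |X| - 1 this
   exceeds |Q|, so some closed path f has nonzero weight and extends to an element
   of arbitrarily large p-power order in larger marked p-groups satisfying the
   same relators.  Hence one can make all words torsion one by one at an
   arbitrarily small cost, and at each step choose between a small and a large order
   for a word of unbounded order; this choice diagonalizes against any countable
   list of kernels, and an isomorphism class accounts for countably many
   kernels only, because A is finitely generated. *)
From HB Require Import structures.
From mathcomp Require Import all_boot all_order all_algebra all_fingroup all_solvable.
From mathcomp Require Import boolp classical_sets functions cardinality.
Require Import Defs.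

Set Implicit Arguments.
Unset Strict Implicit.
Unset Printing Implicit Defensive.

Import Order.TTheory GRing.Theory Num.Theory.
Local Open Scope group_scope.

(** * Words and wreath products *)

Section GroupMorphisms.
Variables (G H : groupType) (f : {multiplicative G -> H}).

Lemma hom1 : f 1 = 1.
Proof. by apply: (mulgI (f 1)); rewrite -gmulfM !mulg1. Qed.

Lemma homV g : f g^-1 = (f g)^-1.
Proof. by apply: (mulgI (f g)); rewrite -gmulfM !mulgV hom1. Qed.

Lemma homX g k : f (g ^+ k) = f g ^+ k.
Proof. by elim: k => [|k IH]; rewrite ?hom1 // !expgS gmulfM IH. Qed.

End GroupMorphisms.

Section Words.
Variables (I : Type) (G : groupType) (x : I -> G).

Lemma eval_letterV (a : I * bool) :
  eval_letter x (inv_letter a) = (eval_letter x a)^-1.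
Proof. by case: a => i [] //=; rewrite /eval_letter /= invgK. Qed.

Lemma eval_word_cat (u v : word I) :
  eval_word x (u ++ v) = eval_word x u * eval_word x v.
Proof. by elim: u => [|a u IH] /=; rewrite ?mul1g // IH mulgA. Qed.

Lemma eval_inv_word (u : word I) : eval_word x (inv_word u) = (eval_word x u)^-1.
Proof.
rewrite /inv_word; elim: u => [|a u IH] /=; first by rewrite invg1.
by rewrite rev_cons -cats1 eval_word_cat IH /= mulg1 eval_letterV invgM.
Qed.

Lemma eval_exp_word (u : word I) k : eval_word x (exp_word u k) = eval_word x u ^+ k.
Proof.
elim: k => [|k IH] //; rewrite /exp_word /= -/(exp_word u k).
by rewrite eval_word_cat IH expgS.
Qed.

Lemma eval_gen_word i : eval_word x (gen_word i) = x i.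
Proof. exact: mulg1. Qed.

Lemma eval_word_morph (H : groupType) (f : {multiplicative G -> H}) (u : word I) :
  f (eval_word x u) = eval_word (f \o x) u.
Proof.
elim: u => [|a u IH] /=; first exact: hom1.
by rewrite gmulfM IH; case: a => i [] //=; rewrite /eval_letter /= homV.
Qed.

Lemma normal_closure_eval (R : word I -> Prop) :
  (forall r, R r -> eval_word x r = 1) ->
  forall w, normal_closure R w -> eval_word x w = 1.
Proof.
move=> xR w; elim=> {w} [r /xR // | // | u v _ u1 _ v1 | u _ u1 | u v _ v1
  | u a v _ uv1 | u a v _ uv1].
- by rewrite eval_word_cat u1 v1 mulg1.
- by rewrite eval_inv_word u1 invg1.
- by rewrite !eval_word_cat eval_inv_word v1 mul1g mulVg.
- by rewrite eval_word_cat /= eval_letterV mulVKg -eval_word_cat.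
- by move: uv1; rewrite !eval_word_cat /= eval_letterV mulVKg.
Qed.

End Words.

Lemma eq_eval_word (I : Type) (G : groupType) (x y : I -> G) (u : word I) :
  x =1 y -> eval_word x u = eval_word y u.
Proof.
by move=> xy; elim: u => [|[i s] u IH] //=; rewrite IH /eval_letter xy.
Qed.

Lemma von_dyck (I : Type) (G H : groupType) (x : I -> G) (y : I -> H)
    (R : word I -> Prop) :
  presented_by x R -> (forall r, R r -> eval_word y r = 1) ->
  exists f : {multiplicative G -> H}, forall w, f (eval_word x w) = eval_word y w.
Proof.
move=> [x_onto x_ker] yR.
have y_resp u v : eval_word x u = eval_word x v -> eval_word y u = eval_word y v.
  move=> uv; apply: divg1_eq; rewrite -eval_inv_word -eval_word_cat.
  apply: (normal_closure_eval yR); apply/x_ker.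
  by rewrite eval_word_cat eval_inv_word uv mulgV.
pose w_of g := sval (cid (x_onto g)).
have w_ofK g : eval_word x (w_of g) = g by rewrite /w_of; case: cid.
pose f g := eval_word y (w_of g).
have fM : {morph f : g h / g * h}.
  by move=> g h; rewrite /f -eval_word_cat; apply: y_resp; rewrite eval_word_cat !w_ofK.
pose fm := HB.pack_for {multiplicative G -> H} f (isMultiplicative.Build G H f fM).
by exists fm => w; apply: y_resp; rewrite w_ofK.
Qed.

(** [B] translates the functions on the right, so that the coordinate at [b] of a product is read
    along the path from [b] in the Cayley graph of [B]. *)
Definition wreath (A B : finGroupType) : Type := ({ffun B -> A} * B)%type.

HB.instance Definition _ (A B : finGroupType) := Finite.on (wreath A B).

Section Wreath.
Variables (A B : finGroupType).

Definition wr_mul (u v : wreath A B) : wreath A B :=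
  ([ffun b => u.1 b * v.1 (b * u.2)], u.2 * v.2).
Definition wr_one : wreath A B := ([ffun=> 1], 1).
Definition wr_inv (u : wreath A B) : wreath A B :=
  ([ffun b => (u.1 (b * u.2^-1))^-1], u.2^-1).

Fact wr_mulA : associative wr_mul.
Proof.
move=> u v w; congr pair; last exact: mulgA.
by apply/ffunP=> b; rewrite !ffunE !mulgA.
Qed.
Fact wr_mul1 : left_id wr_one wr_mul.
Proof.
move=> [u b]; congr pair; last exact: mul1g.
by apply/ffunP=> c; rewrite !ffunE mul1g mulg1.
Qed.
Fact wr_mulV : left_inverse wr_one wr_inv wr_mul.
Proof.
move=> [u b]; congr pair; last exact: mulVg.
by apply/ffunP=> c; rewrite !ffunE mulVg.
Qed.

HB.instance Definition _ :=
  Finite_isGroup.Build (wreath A B) wr_mulA wr_mul1 wr_mulV.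

Lemma wreathP (u v : wreath A B) : u.1 =1 v.1 -> u.2 = v.2 -> u = v.
Proof. by case: u v => u b [v c] /= /ffunP -> ->. Qed.

Lemma wr_mul1E (u v : wreath A B) b : (u * v).1 b = u.1 b * v.1 (b * u.2).
Proof. by rewrite ffunE. Qed.
Lemma wr_mul2E (u v : wreath A B) : (u * v).2 = u.2 * v.2.
Proof. by []. Qed.
Lemma wr_one1E b : (1 : wreath A B).1 b = 1.
Proof. by rewrite ffunE. Qed.
Lemma wr_inv1E (u : wreath A B) b : (u^-1).1 b = (u.1 (b * u.2^-1))^-1.
Proof. by rewrite ffunE. Qed.
Lemma wr_inv2E (u : wreath A B) : (u^-1).2 = u.2^-1.
Proof. by []. Qed.

Lemma wr_exp2E (u : wreath A B) k : (u ^+ k).2 = u.2 ^+ k.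
Proof. by elim: k => // k IH; rewrite !expgS wr_mul2E IH. Qed.

Lemma wr_exp1E (u : wreath A B) k b : u.2 = 1 -> (u ^+ k).1 b = u.1 b ^+ k.
Proof.
move=> u1; elim: k => [|k IH]; first by rewrite !expg0 wr_one1E.
by rewrite !expgS wr_mul1E u1 mulg1 IH.
Qed.

Lemma card_wreath : #|{: wreath A B}| = (#|A| ^ #|B| * #|B|)%N.
Proof. by rewrite card_prod card_ffun. Qed.

Lemma pgroup_wreath p :
  p.-group [set: A] -> p.-group [set: B] -> p.-group [set: wreath A B].
Proof. by rewrite /pgroup !cardsT card_wreath => pA pB; rewrite pnatM pnatX pA pB. Qed.

Lemma eval_word_wr2 (I : Type) (x : I -> wreath A B) (w : word I) :
  (eval_word x w).2 = eval_word (fun i => (x i).2) w.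
Proof.
elim: w => // -[i s] w IH /=; rewrite IH; congr (_ * _).
by rewrite /eval_letter; case: s.
Qed.

End Wreath.

(** * Weights of paths in Cayley graphs *)

Lemma homogeneous_system_rat (T : finType) (ls : seq {ffun T -> rat}) :
  (size ls < #|T|)%N ->
  exists c : T -> rat, (exists t, c t != 0%R) /\
    (forall g, g \in ls -> \sum_t c t * g t = 0)%R.
Proof.
move=> lsT.
pose A := (\matrix_(i < #|T|, j < size ls) (nth 0 ls j) (enum_val i))%R.
have: kermx A != 0%R.
  by rewrite -mxrank_eq0 mxrank_ker -lt0n subn_gt0 (leq_ltn_trans (rank_leq_col A)).
move=> /rowV0Pn [v /sub_kermxP vA v0].
exists (fun t => v 0%R (enum_rank t)); split.
  case/rV0Pn: v0 => i vi; exists (enum_val i); by rewrite enum_valK.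
move=> g /(nthP 0%R) [j jls <-].
move/rowP/(_ (Ordinal jls)): vA; rewrite !mxE => vA0.
rewrite -[RHS]vA0 (reindex _ (onW_bij _ (@enum_val_bij T))) /=.
by apply: eq_bigr => i _; rewrite mxE enum_valK.
Qed.

(** Denominators are cleared because the weights will be reduced modulo powers of p. *)
Lemma homogeneous_system_int (T : finType) (ls : seq {ffun T -> int}) :
  (size ls < #|T|)%N ->
  exists c : T -> int, (exists t, c t != 0%R) /\
    (forall g, g \in ls -> \sum_t c t * g t = 0)%R.
Proof.
move=> lsT.
pose lsq := [seq [ffun t => (g t)%:~R : rat]%R | g : {ffun T -> int} <- ls].
have [|c [[t0 ct0] c_sol]] := @homogeneous_system_rat T lsq; first by rewrite size_map.
pose d := (\prod_t denq (c t))%R.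
have d0 : (d != 0)%R by apply/prodf_neq0 => t _; rewrite denq_neq0.
pose c' t := (numq (c t) * \prod_(u | u != t) denq (c u))%R.
have c'E t : ((c' t)%:~R = c t * d%:~R :> rat)%R.
  rewrite /c' /d [in RHS](bigD1 t) //= !intrM mulrA; congr (_ * _)%R.
  by rewrite -[X in (X * _)%R]divq_num_den divfK // intr_eq0 denq_neq0.
exists c'; split.
  exists t0; rewrite -(intr_eq0 rat) c'E mulf_neq0 //; by rewrite intr_eq0.
move=> g gls; apply/eqP; rewrite -(intr_eq0 rat) rmorph_sum /=.
have /c_sol : [ffun t => (g t)%:~R : rat]%R \in lsq.
  by apply/mapP; exists g.
move=> /(congr1 (fun z => z * d%:~R)%R); rewrite mul0r mulr_suml => sol.
by apply/eqP; rewrite -[RHS]sol; apply: eq_bigr => t _; rewrite intrM c'E ffunE mulrAC.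
Qed.

(* Words are read as paths in the right Cayley graph of the marking s, whose
   edge from q to q * s x carries the weight c (x, q). *)
Fixpoint path_weight (X : Type) (Q : groupType) (V : zmodType) (s : X -> Q)
    (c : X * Q -> V) (w : word X) (q : Q) : V :=
  if w is a :: w' then
    ((if a.2 then - c (a.1, (q * (s a.1)^-1)%g) else c (a.1, q))
      + path_weight s c w' (q * eval_letter s a)%g)%R
  else 0%R.

Section PathWeight.
Variables (X : Type) (Q : groupType) (V : zmodType) (s : X -> Q) (c : X * Q -> V).

Local Notation pw := (path_weight s c).

Lemma path_weight_cat u v q :
  pw (u ++ v) q = (pw u q + pw v (q * eval_word s u)%g)%R.
Proof.
elim: u q => [|a u IH] q /=; first by rewrite add0r mulg1.
by rewrite IH addrA mulgA.
Qed.

Lemma path_weight_inv u q :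
  pw (inv_word u) q = (- pw u (q * (eval_word s u)^-1)%g)%R.
Proof.
rewrite /inv_word; elim: u q => [|a u IH] q /=; first by rewrite oppr0.
rewrite rev_cons -cats1 path_weight_cat IH -/(inv_word u) eval_inv_word /=.
rewrite addr0 opprD addrC invgM mulgA mulgVK; congr (_ - _)%R.
by case: a => x [] //=; rewrite /eval_letter /= opprK invgK mulgK.
Qed.

Lemma path_weight_exp w m q :
  pw (exp_word w m) q = (\sum_(i < m) pw w (q * eval_word s w ^+ i)%g)%R.
Proof.
elim: m q => [|m IH] q; first by rewrite big_ord0.
rewrite /exp_word /= -/(exp_word w m) path_weight_cat IH big_ord_recl mulg1.
by congr (_ + _)%R; apply: eq_bigr => i _; rewrite expgS mulgA.
Qed.

Lemma path_weight_exp_shift w m q : eval_word s w ^+ m = 1 ->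
  pw (exp_word w m) (q * eval_word s w) = pw (exp_word w m) q.
Proof.
move=> wm; rewrite !path_weight_exp; apply/eqP; rewrite -subr_eq0 -sumrB.
under eq_bigr => i _ do rewrite -mulgA -expgS.
pose f i := path_weight s c w (q * eval_word s w ^+ i).
by rewrite -(big_mkord xpredT (fun i => f i.+1 - f i)%R) telescope_sumr // /f wm subrr.
Qed.

End PathWeight.

Lemma path_weight_linear (X : finType) (Q : finGroupType) (s : X -> Q)
    (c : X * Q -> int) w q :
  (path_weight s c w q =
   \sum_t c t * path_weight s (fun u => (u == t)%:R) w q)%R.
Proof.
have delta u : (\sum_t c t * (u == t)%:R = c u :> int)%R.
  rewrite (bigD1 u) //= eqxx mulr1 big1 ?addr0 // => t tu.
  by rewrite eq_sym (negbTE tu) mulr0.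
elim: w q => [|a w IH] q /=; first by rewrite big1 // => t _; rewrite mulr0.
under eq_bigr do rewrite mulrDr.
rewrite big_split /= -IH; congr (_ + _)%R.
case: a => x [] /=; last by rewrite delta.
by under eq_bigr do rewrite mulrN; rewrite sumrN delta.
Qed.

Section WeightedExtension.
Variables (X : Type) (Q : finGroupType) (s : X -> Q) (N : nat) (c : X * Q -> int).

(** Chosen so that the base coordinate at [q] of a word is the weight in ['Z_N] of its path from
    [q]. *)
Definition weight_marking (x : X) : wreath 'Z_N Q :=
  ([ffun q => (c (x, q))%:~R : 'Z_N]%R, s x).

Lemma eval_weight_marking1 w q :
  (eval_word weight_marking w).1 q = ((path_weight s c w q)%:~R : 'Z_N)%R.
Proof.
elim: w q => [|[x b] w IH] q; first by rewrite wr_one1E.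
rewrite [eval_word _ _]/= wr_mul1E IH /= intrD.
by case: b; rewrite /eval_letter /= ?wr_inv1E !ffunE ?intrN.
Qed.

Lemma eval_weight_marking2 w :
  (eval_word weight_marking w).2 = eval_word s w.
Proof. exact: eval_word_wr2. Qed.

End WeightedExtension.

(** The marking need not generate [Q], so the Cayley graph may be disconnected; [base] picks a
    vertex in each component and [W q] a path from it to [q]. *)
Lemma component_paths (X : Type) (Q : finGroupType) (s : X -> Q) :
  exists (base : Q -> Q) (W : Q -> word X),
    (forall q, base q * eval_word s (W q) = q) /\
    (forall q x, base (q * s x) = base q).
Proof.
pose conn q b := `[< exists w, b * eval_word s w = q >].
(* The default 1 is never reached, as [q] is joined to itself by the empty word. *)
pose base q := odflt 1 [pick b | conn q b].
have conn_base q : exists w, base q * eval_word s w = q.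
  rewrite /base; case: pickP => [b /asboolP // | /(_ q)].
  by move/asboolP=> []; exists [::]; rewrite mulg1.
exists base, (fun q => sval (cid (conn_base q))); split=> [q | q x].
  by case: cid.
rewrite /base; congr odflt; apply: eq_pick => b; apply/asboolP/asboolP => -[w wq].
  exists (w ++ inv_word (gen_word x)).
  by rewrite eval_word_cat eval_inv_word eval_gen_word mulgA wq mulgK.
by exists (w ++ gen_word x); rewrite eval_word_cat eval_gen_word mulgA wq.
Qed.

Section NonzeroWeight.
Variables (p : nat) (X : finType) (Q : finGroupType) (s : X -> Q).
Variable R : seq (word X * nat).
Hypothesis p_prime : prime p.
Hypothesis R_order : forall r, r \in R -> #[eval_word s r.1] = (p ^ r.2)%N.

Let loop_eqs (r : word X * nat) : seq {ffun X * Q -> int} :=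
  [seq [ffun t => path_weight s (fun u => (u == t)%:R : int)%R
                    (exp_word r.1 (p ^ r.2)) (repr D)]
  | D : {set Q} <- enum (lcosets <[eval_word s r.1]> [set: Q])].

Let size_loop_eqs r : r \in R ->
  ((size (loop_eqs r))%:R = #|Q|%:R * (p ^ r.2)%:R^-1 :> rat)%R.
Proof.
move=> /R_order wk; rewrite size_map -cardE card_lcosets.
rewrite -cardsT -(Lagrange (finset.subsetT <[eval_word s r.1]>)) -orderE wk.
by rewrite natrM mulrC mulKf // pnatr_eq0 -lt0n expn_gt0 prime_gt0.
Qed.

(* Each relator costs one equation per cycle, as a closed path has the same
   weight from every vertex on it; the equations along the paths W exclude
   coboundaries. *)
Lemma nonzero_weight :
  (\sum_(r <- R) (p ^ r.2)%:R^-1 < #|X|%:R - 1 :> rat)%R ->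
  exists (c : X * Q -> int) (f : word X) (q : Q),
    [/\ forall r, r \in R ->
          forall q, path_weight s c (exp_word r.1 (p ^ r.2)) q = 0%R,
        eval_word s f = 1 & path_weight s c f q != 0%R].
Proof.
move=> R_small; have [base [W [W_base base_edge]]] := component_paths s.
pose delta t (u : X * Q) : int := ((u == t)%:R)%R.
pose path_eqs := [seq [ffun t => path_weight s (delta t) (W q) (base q)] | q : Q].
pose ls := flatten [seq loop_eqs r | r <- R] ++ path_eqs.
(* There are |Q| sum p^-k equations from cycles and |Q| from the paths [W], against |Q| |X|
   unknowns. *)
have size_ls : (size ls < #|{: X * Q}|)%N.
  rewrite -(ltr_nat rat) size_cat natrD size_map -cardT card_prod natrM.
  have -> : ((size (flatten [seq loop_eqs r | r <- R]))%:R
              = #|Q|%:R * \sum_(r <- R) (p ^ r.2)%:R^-1 :> rat)%R.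
    rewrite size_flatten sumnE /shape -map_comp big_map natr_sum mulr_sumr.
    by apply: eq_big_seq => r /size_loop_eqs.
  have Q_gt0 : (0 < #|Q|%:R :> rat)%R.
    by rewrite ltr0n; apply/card_gt0P; exists 1.
  by rewrite -{2}[(#|Q|%:R)%R]mulr1 -mulrDr mulrC ltr_pM2r // -ltrBrDr.
have [c [[[x q] cxq] c_sol]] := homogeneous_system_int size_ls.
have c_zero w q' : [ffun t => path_weight s (delta t) w q'] \in ls ->
    path_weight s c w q' = 0%R.
  move=> /c_sol <-; rewrite path_weight_linear.
  by apply: eq_bigr => t _; rewrite ffunE.
have W0 q' : path_weight s c (W q') (base q') = 0%R.
  apply: c_zero; rewrite mem_cat; apply/orP; right.
  by apply/mapP; exists q'; rewrite ?mem_enum.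
(* The loop runs from the base point to [q], across an edge of nonzero weight, and back. The paths
   [W] have weight 0, so its weight is that of the edge. *)
exists c, (W q ++ gen_word x ++ inv_word (W (q * s x))), (base q); split.
- move=> r rR q'; set w := eval_word s r.1.
  have wk : w ^+ (p ^ r.2) = 1 by rewrite -(R_order rR) expg_order.
  have /lcosetP [_ /cycleP [i ->] rep] : repr (q' *: <[w]>) \in q' *: <[w]>.
    exact: mem_repr (lcoset_refl _ _).
  have <- : path_weight s c (exp_word r.1 (p ^ r.2)) (repr (q' *: <[w]>)) = 0%R.
    apply: c_zero; rewrite mem_cat; apply/orP; left.
    apply/flattenP; exists (loop_eqs r); first exact: map_f.
    apply/mapP; exists (q' *: <[w]>) => //.
    by rewrite mem_enum; apply/lcosetsP; exists q'; rewrite ?inE.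
  rewrite rep; elim: i {rep} => [|i IH]; first by rewrite mulg1.
  by rewrite expgSr mulgA path_weight_exp_shift.
- rewrite !eval_word_cat eval_gen_word eval_inv_word.
  have /(canRL (mulKg _)) -> := W_base (q * s x).
  have /(canRL (mulKg _)) -> := W_base q.
  by rewrite base_edge invgM invgK !mulgA -(mulgA _ q) mulgK mulVg.
- rewrite !path_weight_cat W0 path_weight_inv W_base eval_gen_word.
  have -> : q * s x * (eval_word s (W (q * s x)))^-1 = base (q * s x).
    by rewrite -{1}(W_base (q * s x)) mulgK.
  by rewrite W0 /= oppr0 !addr0 add0r.
Qed.

End NonzeroWeight.

Lemma intr_Zp_eq0 (N : nat) (z : int) : (1 < N)%N ->
  ((z%:~R : 'Z_N) == 0)%R = (N %| `|z|)%N.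
Proof.
move=> N1; have natE (k : nat) : ((k%:R : 'Z_N) == 0)%R = (N %| k)%N.
  by rewrite -(inj_eq val_inj) /= val_Zp_nat // /dvdn.
case: z => k; first exact: natE.
by rewrite NegzE intrN oppr_eq0 abszN natE.
Qed.

(** One loop [f] of weight z <> 0 serves every [K]: its power p^K has weight z p^K, nonzero modulo a
    high power of p, while the relators have weight 0 and stay trivial. *)
Lemma unbounded_extension (p : nat) (X : finType) (Q : finGroupType)
    (s : X -> Q) (R : seq (word X * nat)) :
  prime p -> p.-group [set: Q] ->
  (forall r, r \in R -> #[eval_word s r.1] = (p ^ r.2)%N) ->
  (\sum_(r <- R) (p ^ r.2)%:R^-1 < #|X|%:R - 1 :> rat)%R ->
  exists f : word X, forall K : nat, exists (Q' : finGroupType) (s' : X -> Q'),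
    [/\ p.-group [set: Q'],
        forall w, eval_word s' w = 1 -> eval_word s w = 1,
        forall r, r \in R -> eval_word s' r.1 ^+ (p ^ r.2) = 1
      & eval_word s' f ^+ (p ^ K) != 1].
Proof.
move=> p_prime pQ R_order R_small.
have [c [f [q [cR f1 cf]]]] := nonzero_weight p_prime R_order R_small.
exists f => K; set z := path_weight s c f q in cf.
(* Then p^M exceeds |z| p^K and cannot divide it. *)
pose M := (`|z| * p ^ K).+1; have N1 : (1 < p ^ M)%N.
  exact: leq_ltn_trans (ltn_expl _ (prime_gt1 p_prime)).
exists (wreath 'Z_(p ^ M) Q), (weight_marking s (p ^ M) c); split.
- apply: pgroup_wreath pQ; rewrite /pgroup cardsT card_ord Zp_cast //.
  by rewrite pnatX pnat_id.
- by move=> w w1; rewrite -(eval_weight_marking2 s (p ^ M) c) w1.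
- move=> r rR; rewrite -eval_exp_word; apply: wreathP.
    by move=> b; rewrite eval_weight_marking1 cR // wr_one1E.
  rewrite eval_weight_marking2 eval_exp_word -(R_order r rR).
  exact: expg_order.
- apply/eqP => fK; move: (congr1 (fun u : wreath _ _ => u.1 q) fK).
  rewrite -eval_exp_word eval_weight_marking1 wr_one1E path_weight_exp f1.
  under eq_bigr do rewrite expg1n mulg1.
  rewrite sumr_const card_ord -/z => /eqP.
  change (((z *+ p ^ K)%:~R == 0 :> 'Z_(p ^ M))%R -> False); rewrite intr_Zp_eq0 //.
  rewrite -mulr_natr abszM natz absz_nat => /dvdn_leq.
  rewrite muln_gt0 absz_gt0 cf expn_gt0 prime_gt0 // => /(_ isT).
  rewrite leqNgt => /negP; apply; apply: ltn_trans (ltnSn _) _.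
  exact: ltn_expl (prime_gt1 p_prime).
Qed.

(** * Chains of marked finite p-groups *)

Lemma exp_pow_le (G : groupType) (g : G) (p a b : nat) :
  (a <= b)%N -> g ^+ (p ^ a) = 1 -> g ^+ (p ^ b) = 1.
Proof. by move=> /subnKC <- ga; rewrite expnD expgnA ga expg1n. Qed.

(* A pair (w, k) in stage_rel stands for the relator w ^ (p ^ k). *)
Record stage (X : Type) := Stage {
  stage_group : finGroupType;
  stage_mark : X -> stage_group;
  stage_rel : seq (word X * nat) }.

Definition stage_eval (X : Type) (S : stage X) (w : word X) : stage_group S :=
  eval_word (stage_mark S) w.

(* That w has order exactly p ^ k, and not less, is what keeps the equations
   imposed by the relator down to a proportion 1 / p ^ k. *)
Definition valid_stage (p : nat) (X : finType) (S : stage X) : Prop :=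
  [/\ p.-group [set: stage_group S],
      forall r, r \in stage_rel S -> #[stage_eval S r.1] = (p ^ r.2)%N
    & (\sum_(r <- stage_rel S) (p ^ r.2)%:R^-1 < #|X|%:R - 1 :> rat)%R].

(** The subgroup marked in [S] is a quotient of the one marked in [T], and relators once imposed
    persist. *)
Definition stage_le (X : finType) (S T : stage X) : Prop :=
  (forall w, stage_eval T w = 1 -> stage_eval S w = 1) /\
  {subset stage_rel S <= stage_rel T}.

Lemma stage_le_refl (X : finType) (S : stage X) : stage_le S S.
Proof. by split. Qed.

Lemma stage_le_trans (X : finType) (S T U : stage X) :
  stage_le S T -> stage_le T U -> stage_le S U.
Proof.
by move=> [ST RST] [TU RTU]; split=> [w /TU /ST // | r /RST /RTU].
Qed.

Lemma stage_eval_exp (X : Type) (S : stage X) w k :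
  stage_eval S (exp_word w k) = stage_eval S w ^+ k.
Proof. exact: eval_exp_word. Qed.

Lemma stage_le_exp (X : finType) (S T : stage X) w k :
  stage_le S T -> stage_eval T w ^+ k = 1 -> stage_eval S w ^+ k = 1.
Proof. by move=> [ST _]; rewrite -!stage_eval_exp; apply: ST. Qed.

Section Stages.
Variables (p : nat) (X : finType).
Hypothesis p_prime : prime p.
Implicit Types (S T U : stage X).
Local Notation valid := (@valid_stage p X).

(** Orders can only grow along the chain, so a relator that still holds keeps its exact order, as
    [valid_stage] demands. *)
Lemma stage_order S (T : stage X) w k : stage_le S T ->
  #[stage_eval S w] = (p ^ k)%N -> stage_eval T w ^+ (p ^ k) = 1 ->
  #[stage_eval T w] = (p ^ k)%N.
Proof.
move=> ST Sw /eqP; rewrite -order_dvdn => Tw; apply/eqP; rewrite eqn_dvd Tw /=.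
by rewrite -Sw order_dvdn (stage_le_exp ST) // expg_order.
Qed.

Lemma stage_unbounded S : valid S -> exists f : word X, forall K,
  exists T, [/\ valid T, stage_le S T & stage_eval T f ^+ (p ^ K) != 1].
Proof.
case: S => Q s R [/= pQ ordR smallR].
have [f f_unb] := unbounded_extension p_prime pQ ordR smallR.
exists f => K; have [Q' [s' [pQ' QQ' RQ' fQ']]] := f_unb K.
have le : stage_le (Stage s R) (Stage s' R) by split.
exists (Stage s' R); split=> //; split=> //= r rR.
by apply: (stage_order le); [apply: ordR | apply: RQ'].
Qed.

Lemma small_power (e : rat) : (0 < e)%R -> exists k, ((p ^ k)%:R^-1 < e)%R.
Proof.
move=> e0; have := archi_boundP (ltW (etrans (invr_gt0 e) e0)).
set n := Num.bound _ => en; exists n; rewrite invf_plt ?posrE //; last first.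
  by rewrite ltr0n expn_gt0 prime_gt0.
by apply: lt_trans en _; rewrite ltr_nat ltn_expl ?prime_gt1.
Qed.

(** Either all larger stages kill [w ^ (p ^ k0)], or some stage gives [w] an order p^k with k >= k0;
    imposing that relator costs at most p^-k0, which is within the remaining budget. *)
Lemma stage_torsion S w : valid S -> exists T A, [/\ valid T, stage_le S T &
  forall U, valid U -> stage_le T U -> stage_eval U w ^+ (p ^ A) = 1].
Proof.
move=> vS; have [_ _ smallS] := vS.
have [k0 k0small] : exists k, ((p ^ k)%:R^-1 <
    #|X|%:R - 1 - \sum_(r <- stage_rel S) (p ^ r.2)%:R^-1 :> rat)%R.
  by apply: small_power; rewrite subr_gt0.
have [[T [vT ST wT]] | bounded] := pselect (exists T, [/\ valid T, stage_le S T
    & stage_eval T w ^+ (p ^ k0) != 1]); last first.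
  exists S, k0; split=> // [|U vU SU]; first exact: stage_le_refl.
  by apply/eqP; apply: contra_notT bounded => ?; exists U.
have [pT ordT _] := vT.
have [k wk] : exists k, #[stage_eval T w] = (p ^ k)%N.
  have: p.-nat #[stage_eval T w] by apply: (mem_p_elt pT); rewrite inE.
  by move=> /p_natP [k ->]; exists k.
have k0k : (k0 <= k)%N.
  rewrite leqNgt; apply: contra wT => kk0; apply/eqP.
  by apply: (exp_pow_le (ltnW kk0)); rewrite -wk expg_order.
(* The group is that of [T], but the budget was computed for [S], so any further relators of [T] are
   dropped. *)
exists (Stage (stage_mark T) ((w, k) :: stage_rel S)), k; split.
- split=> //= [r|]; last first.
    rewrite big_cons /= addrC -ltrBrDl; apply: le_lt_trans k0small.
    rewrite lef_pV2 ?posrE ?ltr0n ?expn_gt0 ?prime_gt0 //.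
    by rewrite ler_nat leq_exp2l ?prime_gt1.
  rewrite inE => /orP [/eqP -> // | rS].
  by have [_ RST] := ST; apply/ordT/RST.
- by have [ST1 _] := ST; split=> [|r rS] //=; rewrite inE rS orbT.
- move=> U [_ ordU _] [_ RTU]; rewrite -(ordU (w, k)) ?expg_order //.
  by apply: RTU; rewrite inE eqxx.
Qed.

Lemma stage_torsion_seq S (ws : seq (word X)) : valid S ->
  exists T A, [/\ valid T, stage_le S T & forall U w, valid U -> stage_le T U ->
    w \in ws -> stage_eval U w ^+ (p ^ A) = 1].
Proof.
elim: ws S => [|w ws IH] S vS; first by exists S, 0%N; split=> //; apply: stage_le_refl.
have [T [A [vT ST wT]]] := stage_torsion w vS.
have [U [B [vU TU wsU]]] := IH T vT.
exists U, (maxn A B); split=> //; first exact: stage_le_trans TU.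
move=> V u vV UV; rewrite inE => /orP [/eqP -> | uws].
  by apply: (exp_pow_le (leq_maxl A B)); apply: wT => //; apply: stage_le_trans UV.
by apply: (exp_pow_le (leq_maxr A B)); apply: wsU.
Qed.

End Stages.

(** * Products and images of groups *)

Definition product_group (T : Type) (W : T -> groupType) : Type := forall t, W t.

Section ProductGroup.
Variables (T : Type) (W : T -> groupType).
Local Notation prodW := (product_group W).

HB.instance Definition _ := gen_eqMixin prodW.
HB.instance Definition _ := gen_choiceMixin prodW.

Let mulW (g h : prodW) : prodW := fun t => g t * h t.
Let oneW : prodW := fun t => 1.
Let invW (g : prodW) : prodW := fun t => (g t)^-1.

Fact product_mulA : associative mulW.
Proof. by move=> g h k; apply/functional_extensionality_dep=> t; apply: mulgA. Qed.
Fact product_mul1 : left_id oneW mulW.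
Proof. by move=> g; apply/functional_extensionality_dep=> t; apply: mul1g. Qed.
Fact product_mulr1 : right_id oneW mulW.
Proof. by move=> g; apply/functional_extensionality_dep=> t; apply: mulg1. Qed.
Fact product_mulV : left_inverse oneW invW mulW.
Proof. by move=> g; apply/functional_extensionality_dep=> t; apply: mulVg. Qed.
Fact product_mulrV : right_inverse oneW invW mulW.
Proof. by move=> g; apply/functional_extensionality_dep=> t; apply: mulgV. Qed.

HB.instance Definition _ := isGroup.Build prodW
  product_mulA product_mul1 product_mulr1 product_mulV product_mulrV.

End ProductGroup.

Section Image.
Variables (G H : groupType) (f : {multiplicative G -> H}).

Definition image_pred : {pred H} := [pred h | `[< exists g, f g = h >]].

Fact image_group_closed : group_closed image_pred.
Proof.
split; first by apply/asboolP; exists 1; apply: hom1.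
move=> _ _ /asboolP [g <-] /asboolP [h <-]; apply/asboolP; exists (g * h^-1).
by rewrite gmulfM homV.
Qed.

Definition image_group := {h : H | h \in image_pred}.

HB.instance Definition _ := SubChoice.on image_group.
HB.instance Definition _ :=
  SubChoice_isSubGroup.Build H image_pred image_group image_group_closed.

Lemma image_factorization :
  exists (K : groupType) (e : {multiplicative G -> K}) (i : {multiplicative K -> H}),
    [/\ forall k, exists g, e g = k, injective i & forall g, i (e g) = f g].
Proof.
have fP g : f g \in image_pred by apply/asboolP; exists g.
pose e g : image_group := exist _ (f g) (fP g).
have eM : {morph e : g h / g * h} by move=> g h; apply: val_inj; apply: gmulfM.
pose em := HB.pack_for {multiplicative G -> image_group} e
  (isMultiplicative.Build G image_group e eM).
have vM : {morph (val : image_group -> H) : g h / g * h} by [].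
pose vm := HB.pack_for {multiplicative image_group -> H} (val : image_group -> H)
  (isMultiplicative.Build image_group H val vM).
exists image_group, em, vm; split=> [[h hP]||//]; last exact: val_inj.
by have /asboolP [g gh] := hP; exists g; apply: val_inj.
Qed.

End Image.

Lemma p_power_order (p : nat) (G : groupType) (g : G) N : prime p ->
  g ^+ (p ^ N) = 1 -> exists e, has_order g (p ^ e)%N.
Proof.
move=> p_prime gN; pose P e := g ^+ (p ^ e) == 1.
have exP : exists e, P e by exists N; apply/eqP.
case: (ex_minnP exP) => e /eqP ge e_min; exists e; split=> //.
  by rewrite expn_gt0 prime_gt0.
move=> k /andP [k0 ke] gk.
(* The gcd of k and p^e also kills [g] and is a power of p; minimality of [e] makes it p^e, which
   then divides the smaller k. *)
have [a b kab _] := egcdnP (p ^ e) k0.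
have gd : g ^+ gcdn k (p ^ e) = 1.
  have: g ^+ (a * k) = 1 by rewrite mulnC expgnA gk expg1n.
  by rewrite kab expgnDr mulnC expgnA ge expg1n mul1g.
have /(dvdn_pfactor _ _ p_prime) [d de dE] := dvdn_gcdr k (p ^ e).
have: (e <= d)%N by apply: e_min; rewrite /P -dE gd.
move=> ed; have ed' : e = d by apply/eqP; rewrite eqn_leq ed de.
have: (p ^ e %| k)%N by rewrite ed' -dE dvdn_gcdl.
by move=> /(dvdn_leq k0); rewrite leqNgt ke.
Qed.

Lemma infinite_unbounded (p : nat) (G : groupType) : p_group p G ->
  (forall E, exists g : G, g ^+ (p ^ E) != 1) -> infinite_group G.
Proof.
move=> pG unb /finite_seqP [l lG].
have [E Emax] : exists E, forall g, g \in l -> g ^+ (p ^ E) = 1.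
  elim: l {lG} => [|h l [E IH]]; first by exists 0%N.
  have [e [_ he _]] := pG h; exists (maxn e E) => g; rewrite inE => /orP [/eqP ->|gl].
    exact: exp_pow_le (leq_maxl _ _) he.
  exact: exp_pow_le (leq_maxr _ _) (IH g gl).
have [g /eqP] := unb E; apply; apply: Emax.
by have : [set: G]%classic g by []; rewrite lG.
Qed.

(** * The diagonal argument *)

Section VirtualMarking.
Variables (I : Type) (X : finType) (B : finGroupType).
Variables (beta : I -> B) (f : I -> B -> word X).

Definition virtual_mark (S : stage X) (i : I) : wreath (stage_group S) B :=
  ([ffun b => stage_eval S (f i b)], beta i).

(** A rewriting in the style of Reidemeister and Schreier: its value is the coordinate at [b] of the
    image of [w] in the wreath product. *)
Fixpoint virtual_word (w : word I) (b : B) : word X :=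
  if w is a :: w' then
    (if a.2 then inv_word (f a.1 (b * (beta a.1)^-1)) else f a.1 b)
      ++ virtual_word w' (b * eval_letter beta a)
  else [::].

Lemma virtual_mark1 S w b :
  (eval_word (virtual_mark S) w).1 b = stage_eval S (virtual_word w b).
Proof.
elim: w b => [|[i s] w IH] b; first by rewrite wr_one1E.
rewrite [eval_word _ _]/= wr_mul1E IH [virtual_word _ _]/=.
rewrite [stage_eval _ (_ ++ _)]eval_word_cat; congr (_ * _).
  by case: s; rewrite /eval_letter /= ?wr_inv1E !ffunE // [RHS]eval_inv_word.
by case: s.
Qed.

Lemma virtual_mark2 S w : (eval_word (virtual_mark S) w).2 = eval_word beta w.
Proof. exact: eval_word_wr2. Qed.

Lemma virtual_mark_exp S w k :
  eval_word beta w = 1 ->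
  (forall b, stage_eval S (virtual_word w b) ^+ k = 1) ->
  eval_word (virtual_mark S) w ^+ k = 1.
Proof.
move=> bw wk; apply: wreathP => [b|].
  by rewrite wr_exp1E ?virtual_mark2 // virtual_mark1 wk wr_one1E.
by rewrite wr_exp2E virtual_mark2 bw expg1n.
Qed.

Lemma virtual_mark_le S T w : stage_le S T ->
  eval_word (virtual_mark T) w = 1 -> eval_word (virtual_mark S) w = 1.
Proof.
move=> [ST _] w1; apply: wreathP => [b|].
  rewrite virtual_mark1 wr_one1E; apply: ST.
  by rewrite -virtual_mark1 w1 wr_one1E.
by rewrite virtual_mark2 -(virtual_mark2 T) w1.
Qed.

End VirtualMarking.

Lemma kernel_lift (C D : groupType) (theta : {multiplicative C -> D}) (g : C) :
  theta g = 1 -> exists k : kernel_group theta, val k = g.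
Proof.
move=> tg; have kg : g \in kernel theta by rewrite inE tg.
by exists (Sub g kg : kernel_group theta); apply: SubK.
Qed.

Lemma val_kernelX (C D : groupType) (theta : {multiplicative C -> D})
    (k : kernel_group theta) n : val (k ^+ n) = val k ^+ n.
Proof. by elim: n => // n IH; rewrite !expgS -IH. Qed.

Section Diagonal.
Variables (p : nat) (I : Type) (C D : groupType) (x : I -> C).
Variables (rel : word I -> Prop) (theta : {multiplicative C -> D}).
Variables (X : finType) (B : finGroupType) (beta : I -> B) (f : I -> B -> word X).
Variable S0 : stage X.

Local Notation valid := (@valid_stage p X).
Local Notation vmark := (virtual_mark beta f).
Local Notation Gamma := (kernel_group theta).

Hypothesis p_prime : prime p.
Hypothesis C_pres : presented_by x rel.
Hypothesis S0_valid : valid S0.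
Hypothesis rel_vmark : forall S, valid S -> stage_le S0 S ->
  forall r, rel r -> eval_word (vmark S) r = 1.
Hypothesis vmark_onto : forall t : X, exists w : word I,
  [/\ theta (eval_word x w) = 1, eval_word beta w = 1 &
      forall S, valid S -> stage_le S0 S ->
        (eval_word (vmark S) w).1 1 = stage_mark S t].
Hypothesis beta_torsion : forall w, theta (eval_word x w) = 1 ->
  exists e, eval_word beta w ^+ (p ^ e) = 1.

Lemma vmark_words (u : word X) : exists w : word I,
  [/\ theta (eval_word x w) = 1, eval_word beta w = 1 &
      forall S, valid S -> stage_le S0 S ->
        (eval_word (vmark S) w).1 1 = stage_eval S u].
Proof.
elim: u => [|[t s] u [w [tw bw ew]]].
  by exists [::]; split=> [||S _ _]; rewrite ?hom1 // wr_one1E.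
have [v [tv bv ev]] := vmark_onto t.
exists ((if s then inv_word v else v) ++ w); split.
- rewrite eval_word_cat gmulfM tw mulg1.
  by case: s; rewrite // eval_inv_word homV tv invg1.
- rewrite eval_word_cat bw mulg1.
  by case: s; rewrite // eval_inv_word bv invg1.
- move=> S vS S0S; rewrite eval_word_cat wr_mul1E mul1g.
  case: s; rewrite ?eval_inv_word ?wr_inv1E ?wr_inv2E virtual_mark2 bv ?invg1 ?mulg1;
  by rewrite ev // ew.
Qed.

(** A step makes [u] torsion for good, creates an element not killed by p^i, which forces the limit
    to be infinite, and separates the final kernel from [K] at one element. *)
Lemma diagonal_step (S : stage X) (i : nat) (u : word X) (K : set Gamma) :
  valid S -> stage_le S0 S ->
  exists T, [/\ valid T, stage_le S T,
    exists A, forall U, valid U -> stage_le T U -> stage_eval U u ^+ (p ^ A) = 1,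
    exists v, stage_eval T v ^+ (p ^ i) != 1
  & exists w (g : Gamma), val g = eval_word x w /\
      ((K g /\ eval_word (vmark T) w != 1) \/
       (~ K g /\ forall U, valid U -> stage_le T U -> eval_word (vmark U) w = 1))].
Proof.
move=> vS S0S.
have [T1 [A [vT1 ST1 uA]]] := stage_torsion p_prime u vS.
have [v vunb] := stage_unbounded p_prime vT1.
have [T2 [vT2 T12 vT2i]] := vunb i.
have [f2 f2unb] := stage_unbounded p_prime vT2.
have [w [tw bw ew]] := vmark_words f2.
(* [T3] kills the power p^N of [w] for good, whereas another stage above [T2] keeps that power of
   [f2], hence of [w], nontrivial. The one contradicting [K] is taken. *)
have [T3 [N [vT3 T23 wN]]] :=
  stage_torsion_seq p_prime [seq virtual_word beta f w b | b : B] vT2.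
pose w' := exp_word w (p ^ N).
have [g gw'] : exists g : Gamma, val g = eval_word x w'.
  by apply: kernel_lift; rewrite eval_exp_word homX tw expg1n.
have vlift T : stage_le T2 T -> exists v, stage_eval T v ^+ (p ^ i) != 1.
  move=> T2T; exists v; apply: contra vT2i => /eqP vT; apply/eqP.
  exact: stage_le_exp vT.
have ulift T : stage_le T2 T -> exists A, forall U, valid U -> stage_le T U ->
    stage_eval U u ^+ (p ^ A) = 1.
  move=> T2T; exists A => U vU TU; apply: uA => //.
  exact: stage_le_trans T12 (stage_le_trans T2T TU).
have S2 : stage_le S T2 by apply: stage_le_trans ST1 T12.
have [Kw | nKw] := pselect (K g).
  have [T [vT T2T fT]] := f2unb N.
  exists T; split; [by []|exact: stage_le_trans T2T|exact: ulift|exact: vlift|].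
  exists w', g; split; [by []|left; split=> //].
  apply: contra fT => /eqP wT; apply/eqP.
  have := congr1 (fun z : wreath _ _ => z.1 1) wT.
  rewrite wr_one1E eval_exp_word wr_exp1E ?virtual_mark2 // ew //.
  exact: stage_le_trans S0S (stage_le_trans S2 T2T).
exists T3; split; [by []|exact: stage_le_trans T23|exact: ulift|exact: vlift|].
exists w', g; split; [by []|right; split=> // U vU T3U].
rewrite eval_exp_word; apply: virtual_mark_exp => // b.
by apply: wN => //; apply/mapP; exists b; rewrite ?mem_enum.
Qed.

(* The group G is the image of the kernel in the product of the groups
   (stage_group (S i)) wr B along a chain of stages S i. *)
Lemma diagonal_quotient (K : nat -> set Gamma) :
  exists (G : groupType) (phi : {multiplicative Gamma -> G}),
    [/\ forall h, exists g, phi g = h,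
        [/\ infinite_group G, residually_finite G & p_group p G]
      & forall i, exists g, ~ (K i g <-> phi g = 1)].
Proof.
pose st := {S : stage X | valid S /\ stage_le S0 S}.
(* Step [i] treats the word over [X] with code [i], or the empty word if there is none. *)
pose next_spec i (S T : stage X) := [/\ valid T, stage_le S T,
  exists A, forall U, valid U -> stage_le T U ->
    stage_eval U (odflt [::] (unpickle i)) ^+ (p ^ A) = 1,
  exists v, stage_eval T v ^+ (p ^ i) != 1
  & exists w (g : Gamma), val g = eval_word x w /\
      ((K i g /\ eval_word (vmark T) w != 1) \/
       (~ K i g /\ forall U, valid U -> stage_le T U -> eval_word (vmark U) w = 1))].
have next_ex i (S : st) : exists T : st, next_spec i (sval S) (sval T).
  case: S => S [vS S0S].
  have [T specT] := diagonal_step i (odflt [::] (unpickle i)) (K i) vS S0S.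
  have [vT ST _ _ _] := specT.
  by exists (exist _ T (conj vT (stage_le_trans S0S ST))).
pose S := fix S n : st := if n is i.+1 then sval (cid (next_ex i (S i)))
  else exist _ S0 (conj S0_valid (stage_le_refl S0)).
have S_next i : next_spec i (sval (S i)) (sval (S i.+1)).
  by rewrite [S i.+1]/=; case: cid.
have S_valid i : valid (sval (S i)) by have [] := svalP (S i).
have S_ge i : stage_le S0 (sval (S i)) by have [] := svalP (S i).
have S_mono i j : (i <= j)%N -> stage_le (sval (S i)) (sval (S j)).
  move=> /subnKC <-; elim: (j - i)%N => [|k IH].
    by rewrite addn0; apply: stage_le_refl.
  by rewrite addnS; apply: stage_le_trans IH _; have [] := S_next (i + k)%N.
clearbody S.
pose W i : groupType := wreath (stage_group (sval (S i))) B.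
have homS i : exists h : {multiplicative C -> W i},
    forall w, h (eval_word x w) = eval_word (vmark (sval (S i))) w.
  by apply: (von_dyck C_pres) => r; apply: rel_vmark.
pose h i := sval (cid (homS i)).
have hE i w : h i (eval_word x w) = eval_word (vmark (sval (S i))) w.
  by rewrite /h; case: cid.
clearbody h.
pose F (g : Gamma) : product_group W := fun i => h i (val g).
have FM : {morph F : g k / g * k}.
  move=> g k; apply/functional_extensionality_dep => i.
  exact: (@gmulfM _ _ (h i) (val g) (val k)).
pose Fm := HB.pack_for {multiplicative Gamma -> product_group W} F
  (isMultiplicative.Build Gamma (product_group W) F FM).
have [G [phi [emb [phi_onto emb_inj phiE]]]] := image_factorization Fm.
have F1 g w : val g = eval_word x w ->
    phi g = 1 <-> forall i, eval_word (vmark (sval (S i))) w = 1.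
  move=> gw; split=> [g1 i | w1].
    by rewrite -hE -gw -[LHS]/(Fm g i) -phiE g1 hom1.
  apply: emb_inj; rewrite phiE hom1; apply/functional_extensionality_dep => i.
  by rewrite /= /F gw hE w1.
have torsion g : exists N, phi g ^+ (p ^ N) = 1.
  have [w gw] := C_pres.1 (val g).
  have tw : theta (eval_word x w) = 1 by rewrite gw; apply/eqP; exact: (valP g).
  have [e we] := beta_torsion tw.
  pose w' := exp_word w (p ^ e).
  have bw' : eval_word beta w' = 1 by rewrite eval_exp_word.
  have tors (u : word X) : exists A, forall i,
      stage_eval (sval (S i)) u ^+ (p ^ A) = 1.
    have [_ _ [A uA] _ _] := S_next (pickle u); rewrite pickleK /= in uA.
    (* Torsion descends to earlier stages, which are quotients; later stages obey the choice made at
       step [pickle u]. *)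
    exists A => i; have [iu|ui] := leqP i (pickle u).+1.
      apply: (stage_le_exp (S_mono _ _ iu)); apply: uA => //.
      exact: stage_le_refl.
    by apply: uA => //; apply: S_mono; apply: ltnW.
  have [A bA] : exists A, forall b i,
      stage_eval (sval (S i)) (virtual_word beta f w' b) ^+ (p ^ A) = 1.
    have tors' b := cid (tors (virtual_word beta f w' b)).
    exists (\max_b sval (tors' b)) => b i.
    apply: exp_pow_le (leq_bigmax b) _.
    by case: (tors' b) => /=.
  exists (e + A)%N; rewrite expnD -homX.
  apply/(F1 _ (exp_word w (p ^ e * p ^ A))).
    by rewrite val_kernelX -gw eval_exp_word.
  move=> i; rewrite eval_exp_word expgnA -eval_exp_word -/w'.
  by apply: virtual_mark_exp.
have pG : p_group p G.
  move=> k; have [g <-] := phi_onto k; have [N gN] := torsion g.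
  exact: p_power_order gN.
exists G, phi; split=> //; first split=> //.
- apply: (infinite_unbounded pG) => E.
  have [_ _ _ [v vE] _] := S_next E.
  have [w [tw bw ew]] := vmark_words v.
  have [g gw] := kernel_lift tw; exists (phi g).
  apply: contra vE => /eqP; rewrite -homX => gE.
  have gwE : val (g ^+ (p ^ E)) = eval_word x (exp_word w (p ^ E)).
    by rewrite val_kernelX gw eval_exp_word.
  have /(_ E.+1) wE := (F1 _ _ gwE).1 gE.
  have := congr1 (fun z : wreath _ _ => z.1 1) wE.
  rewrite wr_one1E eval_exp_word wr_exp1E ?virtual_mark2 // ew //.
  by move=> ->.
- move=> k k1.
  (* A nontrivial element survives in some coordinate, and each coordinate group is finite. *)
  have [i ki] : exists i, emb k i != 1.
    apply: contra_notP; last exact/eqP/k1.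
    move=> nk; apply: emb_inj; rewrite hom1.
    apply/functional_extensionality_dep => i.
    by apply/eqP; apply: contra_notT nk => ?; exists i.
  pose P (k : G) : wreath (stage_group (sval (S i))) B := emb k i.
  have PM : {morph P : a b / a * b} by move=> a b; rewrite /P gmulfM.
  pose Pm := HB.pack_for {multiplicative G -> wreath (stage_group (sval (S i))) B} P
    (isMultiplicative.Build G _ P PM).
  by exists (wreath (stage_group (sval (S i))) B), Pm.
- move=> i; have [_ _ _ _ [w [g [gw [[Kg wT]|[nKg wT]]]]]] := S_next i.
    exists g => -[/(_ Kg) /(F1 _ _ gw) /(_ i.+1) w1 _].
    by rewrite w1 eqxx in wT.
  exists g => -[_]; have g1 : phi g = 1; last by move/(_ g1).
  apply/(F1 _ _ gw) => j; have [ji|ij] := leqP j i.+1.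
    apply: (virtual_mark_le (S_mono _ _ ji)); apply: wT => //.
    exact: stage_le_refl.
  by apply: wT => //; apply: S_mono; apply: ltnW.
Qed.

End Diagonal.

(** * Counting quotients up to isomorphism *)

Lemma comp_hom (G H K : groupType) (g : {multiplicative H -> K})
    (f : {multiplicative G -> H}) :
  exists h : {multiplicative G -> K}, h =1 g \o f.
Proof. by exists (g \o f). Qed.

Lemma isomorphic_refl G : isomorphic G G.
Proof. by exists idfun; exists idfun. Qed.

Lemma isomorphic_sym G H : isomorphic G H -> isomorphic H G.
Proof.
move=> [f [g fK gK]].
pose gm := HB.pack_for {multiplicative H -> G} g
  (isMultiplicative.Build H G g (can2_gmulfM fK gK)).
by exists gm; exists f.
Qed.

Lemma isomorphic_trans G H K : isomorphic G H -> isomorphic H K -> isomorphic G K.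
Proof.
move=> [f bij_f] [g bij_g]; have [h hE] := comp_hom g f.
by exists h; apply: eq_bij (bij_comp bij_g bij_f) _ _ => z; rewrite hE.
Qed.

Section UncountableQuotients.
Variables (Gamma : groupType) (I : finType) (a : I -> Gamma).
Variable P : groupType -> Prop.

Hypothesis a_gen : forall g : Gamma, exists w, eval_word a w = g.
Hypothesis diagonal : forall K : nat -> set Gamma,
  exists (G : groupType) (phi : {multiplicative Gamma -> G}),
    [/\ forall h, exists g, phi g = h, P G
      & forall i, exists g, ~ (K i g <-> phi g = 1)].

Lemma hom_eq_gen (H : groupType) (f g : {multiplicative Gamma -> H}) :
  (forall i, f (a i) = g (a i)) -> f =1 g.
Proof.
move=> fg y; have [w <-] := a_gen y.
by rewrite !eval_word_morph; apply: eq_eval_word.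
Qed.

(** If there were countably many classes, a kernel would be determined by the number of its class
    and finitely many words. Such codes are countable, and the diagonal property escapes their
    list. *)
Lemma uncountable_quotients :
  uncountably_many_groups (fun Q => surjects_onto Gamma Q /\ P Q).
Proof.
pose good (K : set Gamma) := exists (G : groupType) (phi : {multiplicative Gamma -> G}),
  [/\ forall h, exists g, phi g = h, P G & forall g, K g <-> phi g = 1].
pose T := {K : set Gamma | good K}.
pose gr (K : T) : groupType := sval (cid (svalP K)).
have grP (K : T) : exists phi : {multiplicative Gamma -> gr K},
    [/\ forall h, exists g, phi g = h, P (gr K) & forall g, sval K g <-> phi g = 1].
  by rewrite /gr; case: cid.
clearbody gr.
pose cls (K : T) : set T := [set L | isomorphic (gr K) (gr L)]%classic.
pose J := {c : set T | exists K, c = cls K}.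
pose rep (c : J) : T := sval (cid (svalP c)).
have repP (c : J) : sval c = cls (rep c) by rewrite /rep; case: cid.
clearbody rep.
exists J, (fun c => gr (rep c)); split; last 2 first.
- move=> c; have [phi [phi_onto PG _]] := grP (rep c).
  by split=> //; exists phi.
- move=> c d cd iso; apply: cd.
  apply: eq_sig_hprop => [? ? ?|]; first exact: Prop_irrelevance.
  rewrite -/(sval c) -/(sval d) !repP; apply/seteqP; split=> L /=.
    exact/isomorphic_trans/isomorphic_sym.
  exact: isomorphic_trans.
move=> /countable_injP [e e_inj].
pose phi K := sval (cid (grP K)).
have phi_onto K h : exists g, phi K g = h by rewrite /phi; case: cid => ? [].
have phi_ker K g : sval K g <-> phi K g = 1 by rewrite /phi; case: cid => ? [].
clearbody phi.
(* [z] holds the class number and, for each generator, a word with the same image in the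
   representative quotient as that generator has under a map with kernel [K]. *)
pose coded (K : set Gamma) (z : nat * {ffun I -> word I}) :=
  exists2 c : J, e c = z.1 & exists chi : {multiplicative Gamma -> gr (rep c)},
    (forall g, K g <-> chi g = 1) /\
    (forall i, phi (rep c) (eval_word a (z.2 i)) = chi (a i)).
have coded_fun K L z : coded K z -> coded L z -> K = L.
  move=> [c ec [chi [chiK chiz]]] [d]; rewrite -ec => /e_inj.
  rewrite !in_setE => /(_ Logic.I Logic.I) -> {d} [chi' [chi'L chi'z]].
  apply/seteqP; split=> g.
    by move=> /chiK g1; apply/chi'L; rewrite -g1; apply: hom_eq_gen => i; rewrite -chiz.
  by move=> /chi'L g1; apply/chiK; rewrite -g1; apply: hom_eq_gen => i; rewrite -chi'z.
have coded_ex K : good K -> exists z, coded K z.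
  move=> goodK; pose K' : T := exist _ K goodK.
  pose c : J := exist _ (cls K') (ex_intro _ K' erefl).
  have [psi bij_psi] : isomorphic (gr K') (gr (rep c)).
    by have : sval c (rep c) by rewrite repP; apply: isomorphic_refl.
  have [chi chiE] := comp_hom psi (phi K').
  have lift i : exists w, phi (rep c) (eval_word a w) = chi (a i).
    have [g gE] := phi_onto (rep c) (chi (a i)).
    by have [w wg] := a_gen g; exists w; rewrite wg.
  exists (e c, [ffun i => sval (cid (lift i))]); exists c => //; exists chi; split.
    move=> g; rewrite chiE /= -(hom1 psi); split=> [/(phi_ker K') -> //|].
    by move/(bij_inj bij_psi)/(phi_ker K').
  by move=> i; rewrite ffunE; case: cid.
pose Kseq j : set Gamma := if unpickle j is Some z
  then xget classical_sets.set0 [set K | coded K z]%classic else classical_sets.set0.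
have [G [f [f_onto PG fK]]] := diagonal Kseq.
pose K : set Gamma := [set g | f g = 1]%classic.
have [|z Kz] := coded_ex K; first by exists G, f; split.
have [g] := fK (pickle z); apply; rewrite /Kseq pickleK.
by case: xgetP => [L _ /= Lz | /(_ K)] //; rewrite (coded_fun _ _ _ Lz Kz).
Qed.

End UncountableQuotients.

(** * Kernels of Coxeter groups *)

Section Coxeter.
Variables (n : nat) (m : 'I_n -> 'I_n -> option nat) (C : groupType).
Variables (x : 'I_n -> C) (theta : {multiplicative C -> 'Z_2}).

Hypothesis C_pres : presented_by x (coxeter_relator m).
Hypothesis theta_x : forall i, theta (x i) = Zp1.

Lemma coxeter_xx i : x i * x i = 1.
Proof.
have /(C_pres.2 _).2 := nc_relator (coxeter_square m i).
by rewrite eval_exp_word eval_gen_word.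
Qed.

Lemma coxeter_xV i : (x i)^-1 = x i.
Proof. exact/mulg1_eq/coxeter_xx. Qed.

Lemma coxeter_xxk (i j : 'I_n) k : (i < j)%N -> m i j = Some k ->
  (x i * x j) ^+ k = 1.
Proof.
move=> ij mk; have /(C_pres.2 _).2 := nc_relator (coxeter_braid ij mk).
by rewrite eval_exp_word eval_word_cat !eval_gen_word.
Qed.

Lemma theta_eval w : theta (eval_word x w) = eval_word (fun=> Zp1 : 'Z_2) w.
Proof. by rewrite eval_word_morph; apply: eq_eval_word => i; apply: theta_x. Qed.

Lemma theta_xx i j : theta (x i * x j) = 1.
Proof. by rewrite gmulfM !theta_x; apply: val_inj. Qed.

(** Every word equals x_{i0}^e times a product of the a_i and their inverses; on the kernel, theta
    forces e = 0. *)
Lemma kernel_coxeter_gen (i0 : 'I_n) : exists a : 'I_n -> kernel_group theta,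
  (forall i, val (a i) = x i0 * x i) /\
  forall g, exists w, eval_word a w = g.
Proof.
pose a i := sval (cid (kernel_lift (theta_xx i0 i))).
have aE i : val (a i) = x i0 * x i by rewrite /a; case: cid.
clearbody a; exists a; split=> // g.
have normal_form w : exists u (e : bool),
    eval_word x w = x i0 ^+ e * val (eval_word a u).
  elim: w => [|[i s] w [u [e we]]]; first by exists [::], false; rewrite mul1g.
  have letterE : eval_letter x (i, s) = x i by case: s; rewrite /eval_letter /= ?coxeter_xV.
  rewrite [eval_word _ _]/= letterE we; case: e {we} => /=.
    exists ((i, true) :: u), false; rewrite expg0 mul1g mulgA.
    have -> : x i * x i0 = (val (a i))^-1 by rewrite aE invgM !coxeter_xV.
    by [].
  exists ((i, false) :: u), true; rewrite expg0 mul1g expg1.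
  rewrite (_ : x i = x i0 * val (a i)); first by rewrite -mulgA.
  by rewrite aE mulgA coxeter_xx mul1g.
have [w gw] := C_pres.1 (val g); have [u [[] we]] := normal_form w; last first.
  by exists u; apply: val_inj; rewrite -gw we expg0 mul1g.
have: theta (val g) = 1 by apply/eqP; exact: (valP g).
have ker1 : theta (val (eval_word a u)) = 1 by apply/eqP; exact: (valP (eval_word a u)).
by rewrite -gw we gmulfM ker1 mulg1 expg1 theta_x.
Qed.

Section Reduction.
Variables (p : nat) (X : finType) (B : finGroupType).
Variables (beta : 'I_n -> B) (f : 'I_n -> B -> word X) (S0 : stage X).
Hypothesis p_prime : prime p.
Hypothesis n_gt0 : (0 < n)%N.
Hypothesis S0_valid : valid_stage p S0.
Hypothesis rel_vmark : forall S, valid_stage p S -> stage_le S0 S ->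
  forall r, coxeter_relator m r -> eval_word (virtual_mark beta f S) r = 1.
Hypothesis vmark_onto : forall t : X, exists w : word 'I_n,
  [/\ eval_word (fun=> Zp1 : 'Z_2) w = 1, eval_word beta w = 1 &
      forall S, valid_stage p S -> stage_le S0 S ->
        (eval_word (virtual_mark beta f S) w).1 1 = stage_mark S t].
Hypothesis beta_torsion : forall w : word 'I_n,
  eval_word (fun=> Zp1 : 'Z_2) w = 1 -> exists e, eval_word beta w ^+ (p ^ e) = 1.

Lemma coxeter_kernel_quotients :
  uncountably_many_groups (fun Q : groupType =>
    [/\ surjects_onto (kernel_group theta) Q, infinite_group Q,
        residually_finite Q & p_group p Q]).
Proof.
have [a [_ a_gen]] := kernel_coxeter_gen (Ordinal n_gt0).
have onto' t : exists w : word 'I_n, [/\ theta (eval_word x w) = 1,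
    eval_word beta w = 1 & forall S, valid_stage p S -> stage_le S0 S ->
        (eval_word (virtual_mark beta f S) w).1 1 = stage_mark S t].
  have [w [w1 bw ew]] := vmark_onto t.
  by exists w; split=> //; rewrite theta_eval.
have tors' w : theta (eval_word x w) = 1 -> exists e, eval_word beta w ^+ (p ^ e) = 1.
  by rewrite theta_eval; apply: beta_torsion.
have diag := diagonal_quotient p_prime C_pres S0_valid rel_vmark onto' tors'.
have [I [Q [I_unc QP Q_iso]]] := uncountable_quotients a_gen diag.
by exists I, Q; split=> // i; have [? []] := QP i.
Qed.

End Reduction.

End Coxeter.

(** * Triangle groups *)

Lemma order_prime_power (p : nat) (G : finGroupType) (g : G) k : prime p ->
  g ^+ (p ^ k.+1) = 1 -> g ^+ (p ^ k) != 1 -> #[g] = (p ^ k.+1)%N.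
Proof.
move=> p_prime gk1 gk.
have /(dvdn_pfactor _ _ p_prime) [j jk gj] : #[g] %| p ^ k.+1.
  by rewrite order_dvdn gk1.
rewrite gj; congr (_ ^ _)%N; apply/eqP; rewrite eqn_leq jk ltnNge.
by apply: contra gk => jk'; rewrite -order_dvdn gj dvdn_exp2l.
Qed.

Lemma expg_div_sym (G : groupType) (g h : G) k : (g * h^-1) ^+ k = 1 ->
  (h * g^-1) ^+ k = 1 /\ (g^-1 * h) ^+ k = 1.
Proof.
move=> gh; have hg : (h * g^-1) ^+ k = 1.
  by rewrite -[h * _]invgK invgM invgK expVgn gh invg1.
split=> //; have -> : g^-1 * h = (h * g^-1) ^ g by rewrite /conjg mulgVK.
by rewrite -conjXg hg conj1g.
Qed.

Section TriangleCase.
Variables (n : nat) (m : 'I_n -> 'I_n -> option nat) (C : groupType).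
Variables (x : 'I_n -> C) (theta : {multiplicative C -> 'Z_2}).
Variables (p e : nat) (Q : finGroupType) (s : bool -> Q).
Variable cls : 'I_n -> option bool.

Hypothesis C_pres : presented_by x (coxeter_relator m).
Hypothesis theta_x : forall i, theta (x i) = Zp1.
Hypothesis p_prime : prime p.
Hypothesis pQ : p.-group [set: Q].
Hypothesis s_order : forall t, #[s t] = p.
Hypothesis ss_order : #[s false * (s true)^-1] = (p ^ e)%N.
Hypothesis e_small : ((p%:R^-1 + p%:R^-1 + (p ^ e)%:R^-1 : rat) < 1)%R.
Hypothesis cls_onto : forall c, exists i, cls i = c.
Hypothesis label_p : forall (i j : 'I_n) k, (i < j)%N -> m i j = Some k -> (p %| k)%N.
Hypothesis label_pe : forall (i j : 'I_n) k, (i < j)%N -> m i j = Some k ->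
  cls i != cls j -> cls i -> cls j -> (p ^ e %| k)%N.

Let y (i : 'I_n) : word bool := oapp (@gen_word bool) [::] (cls i).

Let S0 : stage bool := @Stage bool Q s
  [:: (gen_word false, 1%N); (gen_word true, 1%N);
      (gen_word false ++ inv_word (gen_word true), e)].

(** Mutually inverse coordinates make x_i an involution and give x_i x_j the coordinates y_i y_j^-1
    and y_i^-1 y_j. The tested [1] is the group identity of ['Z_2]. *)
Let f (i : 'I_n) (b : 'Z_2) : word bool := if b == 1 then y i else inv_word (y i).

Let S0_valid : valid_stage p S0.
Proof.
split=> //=.
  move=> r; rewrite !inE /stage_eval => /or3P [] /eqP -> /=.
  - by rewrite mulg1 expn1 s_order.
  - by rewrite mulg1 expn1 s_order.
  - by rewrite mulg1.
rewrite !big_cons big_nil card_bool /= expn1 addr0.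
by rewrite (_ : (2%:R - 1 = 1 :> rat)%R) // addrA.
Qed.

(** Equal classes give 1, a single class [None] gives a generator or its inverse, and only the
    remaining pair involves the exponent p^e. *)
Let y_rel (S : stage bool) : valid_stage p S -> stage_le S0 S ->
  forall (i j : 'I_n) k, (i < j)%N -> m i j = Some k ->
  (stage_eval S (y i) * (stage_eval S (y j))^-1) ^+ k = 1.
Proof.
move=> [_ ordS _] [_ relS] i j k ij mk.
have St t : stage_eval S (gen_word t) ^+ k = 1.
  have /dvdnP [l ->] := label_p ij mk.
  have /ordS /= St : (gen_word t, 1%N) \in stage_rel S.
    by apply: relS; rewrite !inE; case: t; rewrite eqxx ?orbT.
  by rewrite mulnC expgnA -{1}(expn1 p) -St expg_order expg1n.
have Stt : cls i != cls j -> cls i -> cls j ->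
    (stage_eval S (gen_word false) * (stage_eval S (gen_word true))^-1) ^+ k = 1.
  move=> ci cj cij; have /dvdnP [l ->] := label_pe ij mk ci cj cij.
  have : #[stage_eval S (gen_word false ++ inv_word (gen_word true))] = (p ^ e)%N.
    by apply: (ordS (_, e)); apply: relS; rewrite !inE eqxx !orbT.
  rewrite /stage_eval eval_word_cat eval_inv_word => Sft.
  by rewrite mulnC expgnA -Sft expg_order expg1n.
pose g t := stage_eval S (gen_word t).
have gE c : stage_eval S (oapp (@gen_word bool) [::] c) = oapp g 1 c by case: c.
rewrite /y !gE; case: (cls i) Stt => [ci|]; case: (cls j) => [cj|] /= Stt.
- have [<-|cij] := eqVneq ci cj; first by rewrite mulgV expg1n.
  case: ci cj Stt cij => [] [] //= Stt _; last exact: Stt.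
  by have [] := expg_div_sym (Stt isT isT isT).
- by rewrite invg1 mulg1 St.
- by rewrite mul1g expVgn St invg1.
- by rewrite mulgV expg1n.
Qed.

Let vmark_mul1 S i j : 
  let v := (virtual_mark (fun=> Zp1) f S i * virtual_mark (fun=> Zp1) f S j) in
  let yi := stage_eval S (y i) in let yj := stage_eval S (y j) in
  v.2 = 1 /\ forall b, v.1 b = if b == 1 then yi * yj^-1 else yi^-1 * yj.
Proof.
move=> v yi yj; split; first by apply: val_inj.
move=> b; rewrite /v wr_mul1E !ffunE /= /f.
case: b => [[|[|//]] bP] /=; rewrite /stage_eval eval_inv_word //.
Qed.

Lemma triangle_kernel_quotients :
  uncountably_many_groups (fun Q : groupType =>
    [/\ surjects_onto (kernel_group theta) Q, infinite_group Q,
        residually_finite Q & p_group p Q]).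
Proof.
have n_gt0 : (0 < n)%N.
  by have [[i i_lt] _] := cls_onto None; apply: leq_ltn_trans i_lt.
apply: (@coxeter_kernel_quotients _ _ _ _ _ C_pres theta_x p _ _ (fun=> Zp1) f S0) => //.
- move=> S vS S0S r [i | i j k ij mk].
    rewrite eval_exp_word eval_gen_word expg2.
    have [v2 v1] := vmark_mul1 S i i; apply: wreathP => [b|]; last exact: v2.
    by rewrite v1 wr_one1E mulgV mulVg if_same.
  rewrite eval_exp_word eval_word_cat !eval_gen_word.
  have [v2 v1] := vmark_mul1 S i j; apply: wreathP => [b|].
    rewrite wr_exp1E // v1 wr_one1E.
    have yk := y_rel vS S0S ij mk; have [_ yk'] := expg_div_sym yk.
    by case: ifP.
  by rewrite wr_exp2E v2 expg1n.
- move=> t; have [i ci] := cls_onto (Some t); have [j cj] := cls_onto None.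
  exists (gen_word i ++ gen_word j); split; [exact: val_inj | exact: val_inj |].
  move=> S vS S0S; have [_ v1] := vmark_mul1 S i j.
  rewrite eval_word_cat !eval_gen_word v1 eqxx /y ci cj /= invg1 mulg1.
  exact: eval_gen_word.
- by move=> w ->; exists 0%N.
Qed.

End TriangleCase.

(** * The ideal tetrahedron *)

(* The pair (u, e) encodes the affine map v |-> (-1) ^ e * v + u of A. *)
Definition dihedral (A : finZmodType) : Type := (A * bool)%type.

HB.instance Definition _ (A : finZmodType) := Finite.on (dihedral A).

Section Dihedral.
Variable A : finZmodType.

Definition signed (e : bool) (u : A) : A := if e then (- u)%R else u.

Definition dih_mul (g h : dihedral A) : dihedral A :=
  ((g.1 + signed g.2 h.1)%R, g.2 (+) h.2).
Definition dih_one : dihedral A := (0%R, false).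
Definition dih_inv (g : dihedral A) : dihedral A := ((- signed g.2 g.1)%R, g.2).

Fact dih_mulA : associative dih_mul.
Proof.
move=> [u a] [v b] [w c]; rewrite /dih_mul /= addbA -addrA; congr ((_ + _)%R, _).
by case: a; case: b; rewrite /= ?opprD ?opprK.
Qed.
Fact dih_mul1 : left_id dih_one dih_mul.
Proof. by move=> [u a]; rewrite /dih_mul /= add0r. Qed.
Fact dih_mulV : left_inverse dih_one dih_inv dih_mul.
Proof.
by move=> [u []]; rewrite /dih_mul /dih_inv /dih_one /= ?opprK ?addrN ?addNr.
Qed.

HB.instance Definition _ :=
  Finite_isGroup.Build (dihedral A) dih_mulA dih_mul1 dih_mulV.

Lemma dih_exp (u : A) k : ((u, false) : dihedral A) ^+ k = ((u *+ k)%R, false).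
Proof. by elim: k => // k IH; rewrite expgS IH mulrS. Qed.

End Dihedral.

Fixpoint free_reduce (I : eqType) (w : word I) : word I :=
  if w is a :: w' then
    let v := free_reduce w' in
    if v is b :: v' then if b == inv_letter a then v' else a :: v else [:: a]
  else [::].

Lemma eval_free_reduce (I : eqType) (G : groupType) (x : I -> G) (w : word I) :
  eval_word x (free_reduce w) = eval_word x w.
Proof.
elim: w => // a w /= <-; case: (free_reduce w) => [|b v] //=.
by case: eqP => // ->; rewrite eval_letterV mulVKg.
Qed.


Definition Z3cube : Type := ('Z_3 * 'Z_3 * 'Z_3)%type.
HB.instance Definition _ := GRing.Zmodule.on Z3cube.
HB.instance Definition _ := Finite.on Z3cube.

(** Four affinely independent points. Indices above 3 repeat the last one, which folds every n >= 4
    onto the tetrahedron. *)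
Definition simplex_vertex (i : nat) : Z3cube :=
  match i with
  | 0 => (0, 0, 0) | 1 => (1, 0, 0) | 2 => (0, 1, 0) | _ => (0, 0, 1)
  end%R.

Definition simplex_refl (i : nat) : dihedral Z3cube := (simplex_vertex i, true).

(* The wall of a reflection v |-> r - v is crossed by the edge from g to
   g * simplex_refl i exactly when r is 2 u +- simplex_vertex i.  The two walls
   chosen here are disjoint, as neither (0, 2, 2) nor its opposite is a difference
   of two vertices; each gives a generator of the free group. *)
Definition wall_word (r : Z3cube) : word bool :=
  if r == (0, 0, 0)%R then gen_word false
  else if r == (0, 1 + 1, 1 + 1)%R then gen_word true else [::].

(** The parity of [g] orients the crossing: an edge traversed backwards meets the same wall and
    gives the inverse word. *)
Definition crossing_word (i : nat) (g : dihedral Z3cube) : word bool :=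
  let w := wall_word (g.1 + g.1 + signed g.2 (simplex_vertex i))%R in
  if g.2 then inv_word w else w.

Definition dihedral_Z3cube_elements : seq (dihedral Z3cube) :=
  let Z3 := [:: 0; 1; 1 + 1]%R in
  [seq (u, e) | u <- [seq (v, c) | v <- [seq (a, b) | a <- Z3, b <- Z3], c <- Z3],
                e <- [:: false; true]].

Lemma mem_dihedral_Z3cube g : g \in dihedral_Z3cube_elements.
Proof. by case: g => [[[[[|[|[|//]]] a] [[|[|[|//]]] b]] [[|[|[|//]]] c]] []]. Qed.

(** A computable certificate valid for all marked groups at once: every coordinate is trivial
    already in the free group. *)
Definition crossing_check (w : word nat) :=
  (eval_word simplex_refl w == 1) &&
  all (fun g => free_reduce (virtual_word simplex_refl crossing_word w g) == [::])
    dihedral_Z3cube_elements.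

Lemma crossing_checkP (S : stage bool) w : crossing_check w ->
  eval_word (virtual_mark simplex_refl crossing_word S) w = 1.
Proof.
move=> /andP [/eqP w1 /allP w_red]; apply: wreathP => [g|].
  rewrite virtual_mark1 wr_one1E /stage_eval -eval_free_reduce.
  by rewrite (eqP (w_red g (mem_dihedral_Z3cube g))).
by rewrite virtual_mark2.
Qed.

Lemma simplex_crossing_checks :
  all (fun i => crossing_check (exp_word (gen_word i) 2)) (iota 0 4) &&
  all (fun i => all (fun j =>
         crossing_check (exp_word (gen_word i ++ gen_word j) 3)) (iota 0 4)) (iota 0 4).
Proof. by vm_compute. Qed.

Lemma virtual_mark_min3 (S : stage bool) i :
  virtual_mark simplex_refl crossing_word S i =
  virtual_mark simplex_refl crossing_word S (minn i 3).
Proof. by case: i => [|[|[|i]]]. Qed.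

Lemma simplex_crossing_rel (S : stage bool) (i j k : nat) :
  let v := virtual_mark simplex_refl crossing_word S in
  v i ^+ 2 = 1 /\ ((3 %| k)%N -> (v i * v j) ^+ k = 1).
Proof.
move=> v; have /andP [/allP sq /allP br] := simplex_crossing_checks.
have min4 l : minn l 3 \in iota 0 4 by rewrite mem_iota ltnS geq_minr.
have vmin l : v l = v (minn l 3) by apply: virtual_mark_min3.
split=> [|/dvdnP [l ->]].
  have := crossing_checkP S (sq _ (min4 i)).
  by rewrite eval_exp_word eval_gen_word -/v -vmin.
have /allP br' := br _ (min4 i); have := crossing_checkP S (br' _ (min4 j)).
rewrite eval_exp_word eval_word_cat !eval_gen_word -/v -!vmin => v3.
by rewrite mulnC expgnA v3 expg1n.
Qed.

Lemma eval_word_map (I J : Type) (G : groupType) (x : J -> G) (h : I -> J) w :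
  eval_word (fun i => x (h i)) w = eval_word x [seq (h a.1, a.2) | a <- w].
Proof. by elim: w => //= -[i s] w ->. Qed.

Section SimplexCase.
Variables (n : nat) (m : 'I_n -> 'I_n -> option nat) (C : groupType).
Variables (x : 'I_n -> C) (theta : {multiplicative C -> 'Z_2}).

Hypothesis C_pres : presented_by x (coxeter_relator m).
Hypothesis theta_x : forall i, theta (x i) = Zp1.
Hypothesis n_ge4 : (4 <= n)%N.
Hypothesis label_3 : forall (i j : 'I_n) k, (i < j)%N -> m i j = Some k -> (3 %| k)%N.

Let beta (i : 'I_n) := simplex_refl i.
Let f (i : 'I_n) := crossing_word i.
Let S0 : stage bool := @Stage bool ('Z_3)%type (fun=> 1) [::].

Let beta_parity (w : word 'I_n) :
  eval_word (fun=> Zp1 : 'Z_2) w = if (eval_word beta w).2 then Zp1 else 1.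
Proof.
elim: w => // -[i s] w IH; rewrite [LHS]/= IH [eval_word beta (_ :: _)]/=.
case: (eval_word beta w) => u c.
by case: s; case: c; apply: val_inj.
Qed.

Let simplex_onto (t : bool) : exists w : word 'I_n,
  [/\ eval_word (fun=> Zp1 : 'Z_2) w = 1, eval_word beta w = 1 &
      forall S, (eval_word (virtual_mark beta f S) w).1 1 = stage_mark S t].
Proof.
pose o l (l4 : (l < 4)%N) : 'I_n := Ordinal (leq_trans l4 n_ge4).
(* A product of three of the reflections is an involution, so its square is a loop; these two loops
   spell the two free generators after reduction. *)
pose w : word 'I_n := flatten (nseq 2 (if t
  then [:: (@o 1%N isT, false); (@o 2%N isT, false); (@o 3%N isT, false)]
  else [:: (@o 0%N isT, false); (@o 1%N isT, false); (@o 2%N isT, false)])).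
pose w' : word nat := flatten (nseq 2 (if t
  then [:: (1%N, false); (2%N, false); (3%N, false)]
  else [:: (0%N, false); (1%N, false); (2%N, false)])).
have ww' : [seq (nat_of_ord a.1, a.2) | a <- w] = w' by rewrite /w /w'; case: (t).
have w'1 : eval_word simplex_refl w' = 1.
  by apply/eqP; rewrite /w'; case: (t); vm_compute.
have w'red : free_reduce (virtual_word simplex_refl crossing_word w' 1) = gen_word t.
  by rewrite /w'; case: (t); vm_compute.
exists w; split.
- by apply: val_inj; rewrite /w; case: (t).
- by rewrite /beta (eval_word_map simplex_refl (@nat_of_ord n)) ww'.
- move=> S; rewrite (eval_word_map (virtual_mark simplex_refl crossing_word S)
    (@nat_of_ord n)) ww' virtual_mark1 /stage_eval -eval_free_reduce w'red.
  exact: eval_gen_word.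
Qed.

Lemma simplex_kernel_quotients :
  uncountably_many_groups (fun Q : groupType =>
    [/\ surjects_onto (kernel_group theta) Q, infinite_group Q,
        residually_finite Q & p_group 3 Q]).
Proof.
apply: (@coxeter_kernel_quotients _ _ _ _ _ C_pres theta_x 3 _ _ beta f S0) => //.
- exact: leq_trans n_ge4.
- split=> //=; first by rewrite /pgroup cardsT card_ord.
  by rewrite big_nil card_bool.
- move=> S _ _ r [i | i j k ij mk]; rewrite eval_exp_word.
    by rewrite eval_gen_word; have [-> ] := simplex_crossing_rel S i i 0.
  rewrite eval_word_cat !eval_gen_word.
  by have [_] := simplex_crossing_rel S i j k; apply; apply: label_3 mk.
- by move=> t; have [w [? ? ew]] := simplex_onto t; exists w; split.
- move=> w; rewrite beta_parity; case: (eval_word beta w) => u [] // _.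
  exists 1%N; rewrite dih_exp.
  have /allP torsion : all (fun g : dihedral Z3cube => g.1 *+ 3 == 0)%R
      dihedral_Z3cube_elements by vm_compute.
  by have /eqP -> := torsion _ (mem_dihedral_Z3cube (u, false)).
Qed.

End SimplexCase.

(** * Initial markings and virtually abelian kernels *)

(** In Z/p the elements 1 and 2 and their difference are nonzero, hence of order p. *)
Lemma cyclic_triangle_stage (p : nat) : prime p -> (3 < p)%N ->
  exists (Q : finGroupType) (s : bool -> Q),
    [/\ p.-group [set: Q], forall t, #[s t] = p
      & #[s false * (s true)^-1] = (p ^ 1)%N].
Proof.
move=> p_prime p3; have p1 : (1 < p)%N := prime_gt1 p_prime.
have nz (r : nat) : (0 < r < p)%N -> ((r%:R : 'Z_p) != 0)%R.
  by move=> /andP [r0 rp]; rewrite (intr_Zp_eq0 r p1) gtnNdvd.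
have ord_p (g : 'Z_p) : (g != 0)%R -> #[g] = (p ^ 1)%N.
  move=> g0; apply: order_prime_power => //.
  by rewrite FinRing.zmodXgE expn1 -mulr_natr pchar_Zp // mulr0.
exists ('Z_p)%type, (fun t : bool => if t then 2%:R else 1%:R)%R; split.
- by rewrite /pgroup cardsT card_ord Zp_cast // pnat_id.
- move=> t; rewrite -[RHS]expn1; case: t; apply: ord_p; apply: nz => //.
  exact: ltn_trans p3.
- apply: ord_p; rewrite FinRing.zmodMgE FinRing.zmodVgE -opprB oppr_eq0 -natrB //.
Qed.

(** In Z/3 wr Z/3 take the shift a and the delta function b. The cube of a b^-1 sums the values of
    b^-1 around the cycle, giving the constant function -1, so the order is 9. *)
Lemma wreath_triangle_stage :
  exists (Q : finGroupType) (s : bool -> Q),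
    [/\ 3.-group [set: Q], forall t, #[s t] = 3
      & #[s false * (s true)^-1] = (3 ^ 2)%N].
Proof.
have cube0 (u : 'Z_3) : u ^+ 3 = 1 by rewrite FinRing.zmodXgE -mulr_natr pchar_Zp // mulr0.
have p3 : 3.-group [set: 'Z_3] by rewrite /pgroup cardsT card_ord.
have cube (g : wreath 'Z_3 'Z_3) : g.2 = 1 -> g ^+ 3 = 1.
  move=> g2; apply: wreathP => [c|]; first by rewrite wr_exp1E // wr_one1E cube0.
  by rewrite wr_exp2E g2.
pose a : wreath 'Z_3 'Z_3 := ([ffun=> 0%R], 1%R).
pose b : wreath 'Z_3 'Z_3 := ([ffun c => if c == 0%R then 1%R else 0%R], 0%R).
exists (wreath 'Z_3 'Z_3), (fun t : bool => if t then b else a); split.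
- exact: pgroup_wreath.
- move=> t; apply: (@order_prime_power 3 _ _ 0) => //; rewrite ?expn0 ?expn1 ?expg1.
    case: t; first exact: cube.
    apply: wreathP => [c|]; last by rewrite wr_exp2E cube0.
    by rewrite !expgS expg0 mulg1 !wr_mul1E !ffunE; apply: val_inj.
  case: t; apply/eqP; last by move=> /(congr1 snd).
  by move/(congr1 (fun z : wreath 'Z_3 'Z_3 => z.1 0%R)); rewrite !ffunE.
- apply: order_prime_power => //.
    by rewrite expnS expgnA cube // wr_exp2E cube0.
  apply/eqP; rewrite expn1 => /(congr1 (fun z : wreath 'Z_3 'Z_3 => z.1 0%R)).
  by rewrite !expgS expg0 mulg1 !wr_mul1E !wr_inv1E !ffunE /=.
Qed.

Lemma eval_word_commute (I : Type) (G : groupType) (x : I -> G) (g : G) w :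
  (forall i, commute g (x i)) -> commute g (eval_word x w).
Proof.
move=> gx; elim: w => [|[i s] w IH]; first exact: commute1.
by apply: commuteM _ IH; case: s; [apply: commuteV|]; apply: gx.
Qed.

Lemma abelian_virtually_abelian (G : groupType) :
  (forall g h : G, commute g h) -> virtually_abelian G.
Proof.
move=> abG; exists (fun=> true); split=> //; first by move=> g h _ _; apply: abG.
by exists [:: 1] => g; exists 1; rewrite ?inE.
Qed.

(* The translations g h and h g of the Euclidean triangle group generate an
   abelian normal subgroup with quotient generated by the image of g. *)
Lemma euclidean_triangle_virtually_abelian (G : groupType) (s : bool -> G) :
  (forall g, exists w, eval_word s w = g) ->
  (forall t, s t ^+ 3 = 1) -> (s false * (s true)^-1) ^+ 3 = 1 ->
  virtually_abelian G.
Proof.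
set g := s false; set h := s true; move=> s_gen s3 gh3.
have g3 : g ^+ 3 = 1 := s3 false; have h3 : h ^+ 3 = 1 := s3 true.
have sqV (u : G) : u ^+ 3 = 1 -> u * u = u^-1.
  by move=> u3; apply/esym/mulg1_eq; rewrite -u3 !expgS mulg1.
pose u (t : bool) := if t then h * g else g * h.
pose A : {pred G} := fun k => `[< exists w : word bool, eval_word u w = k >].
have AP k : reflect (exists w : word bool, eval_word u w = k) (k \in A).
  exact: asboolP.
have uM : g * h^-1 * g = h * g^-1 * h.
  apply: (mulIg (h^-1 * g * h^-1)).
  rewrite !mulgA mulgK mulgVK mulgV -gh3 !expgS expg0 mulg1 !mulgA.
  by [].
(* Since g^2 = g^-1 and h^2 = h^-1, the two products are h g^-1 h and g h^-1 g. *)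
have u_comm : commute (u true) (u false).
  by rewrite /commute /= -!mulgA (mulgA g g h) (mulgA h h g) !sqV // !mulgA uM.
have u_commute t t' : commute (u t) (u t').
  by case: t t' => [] []; rewrite // /commute.
have A1 : 1 \in A by apply/AP; exists [::].
have AV : {in A, forall k, k^-1 \in A}.
  by move=> _ /AP [w <-]; apply/AP; exists (inv_word w); rewrite eval_inv_word.
have AM : {in A &, forall k l, k * l \in A}.
  by move=> _ _ /AP [w <-] /AP [v <-]; apply/AP; exists (w ++ v); rewrite eval_word_cat.
have uA t : u t \in A by apply/AP; exists (gen_word t); rewrite eval_gen_word.
have AJ : {in A, forall k, k ^ g \in A}.
  have uJ t : u t ^ g \in A.
    case: t; rewrite /conjg /u.
      have -> : g^-1 * (h * g * g) = (u false * u true)^-1.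
        by rewrite /u -(mulgA g h) (mulgA h h g) sqV // !invgM invgK -!mulgA sqV.
      by apply/AV/AM.
    by rewrite -mulgA mulKg; apply: (uA true).
  move=> _ /AP [w <-]; elim: w => [|[t e] w IH]; first by rewrite conj1g.
  rewrite [eval_word _ _]/= conjMg AM //.
  by case: e; rewrite /eval_letter /= ?conjVg ?AV.
have AJX k l : k \in A -> k ^ (g ^+ l) \in A.
  by move=> kA; elim: l => [|l IH]; rewrite ?conjg1 // expgSr conjgM AJ.
(* Modulo [A], h acts as g^-1; [l.+2] stands for l - 1 because g^3 = 1. *)
have coset k : exists l, (g ^+ l)^-1 * k \in A.
  have [w <-] := s_gen k; elim: w => [|[t e] w [l IH]]; first by exists 0%N; rewrite mulg1 invg1.
  rewrite [eval_word _ _]/=; set k' := eval_word s w in IH *.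
  case: t; last first.
    case: e; rewrite /eval_letter /= -/g.
      by exists l.+2; rewrite mulgA -invgM -expgS (expgnDr g 3 l) g3 mul1g.
    by exists l.+1; rewrite expgS invgM mulgA mulgVK.
  case: e; rewrite /eval_letter /= -/h.
    exists l.+1; have -> : (g ^+ l.+1)^-1 * (h^-1 * k') =
        (u false)^-1 ^ (g ^+ l.+1) * ((g ^+ l)^-1 * k').
      rewrite /conjg -!mulgA; congr (_ * _).
      by rewrite expgS -mulgA mulVKg /u invgM -mulgA mulKg.
    by rewrite AM // AJX // AV // uA.
  exists l.+2; have -> : (g ^+ l.+2)^-1 * (h * k') =
      u false ^ (g ^+ l) * ((g ^+ l)^-1 * k').
    by rewrite /conjg -!mulgA mulVKg !expgS (mulgA g g) sqV // invgM invgK /u -!mulgA.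
  by rewrite AM // AJX // uA.
exists A; split; first by split=> // k l kA lA; rewrite AM ?AV.
  move=> _ _ /AP [w <-] /AP [v <-]; apply: eval_word_commute => t.
  by apply/commute_sym; apply: eval_word_commute => t'.
exists [seq g ^+ l | l <- iota 0 3] => k; have [l kl] := coset k.
exists (g ^+ (l %% 3)); last first.
  by rewrite {1}(divn_eq l 3) expgnDr mulnC expgnA g3 expg1n mul1g in kl.
by apply: map_f; rewrite mem_iota ltn_mod.
Qed.

Section SmallCoxeter.
Variables (n : nat) (m : 'I_n -> 'I_n -> option nat) (C : groupType).
Variables (x : 'I_n -> C) (theta : {multiplicative C -> 'Z_2}).
Hypothesis C_pres : presented_by x (coxeter_relator m).
Hypothesis theta_x : forall i, theta (x i) = Zp1.

(** The kernel is cyclic, generated by x_0 x_1. *)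
Lemma rank2_kernel_virtually_abelian : n = 2 ->
  virtually_abelian (kernel_group theta).
Proof.
move=> n2; have n_gt0 : (0 < n)%N by rewrite n2.
have [a [aE a_gen]] := kernel_coxeter_gen C_pres theta_x (Ordinal n_gt0).
have a0 i : val i = 0%N -> a i = 1.
  move=> i0; apply: val_inj; rewrite aE -(_ : i = Ordinal n_gt0); last exact: val_inj.
  exact: coxeter_xx C_pres i.
have n_gt1 : (1 < n)%N by rewrite n2.
have a01 i : a i = 1 \/ a i = a (Ordinal n_gt1).
  case: i => [[|[|l]] l_n]; [left; exact: a0 | right | by exfalso; move: l_n; rewrite n2].
  by congr a; apply: val_inj.
have a_comm i j : commute (a i) (a j).
  case: (a01 i) => ->; first exact/commute_sym/commute1.
  by case: (a01 j) => ->; [apply: commute1 | ].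
apply: abelian_virtually_abelian => g h.
have [w <-] := a_gen g; have [v <-] := a_gen h.
by apply: eval_word_commute => i; apply/commute_sym; apply: eval_word_commute.
Qed.

(** The kernel is generated by x_0 x_1 and x_0 x_2 of cube 1, and the quotient of the first by the
    second is conjugate to x_1 x_2. *)
Lemma euclidean_kernel_virtually_abelian : n = 3 ->
  (forall i j : 'I_n, (i < j)%N -> m i j = Some 3) ->
  virtually_abelian (kernel_group theta).
Proof.
move=> n3 m3; have lt3 l : (l < 3)%N -> (l < n)%N by rewrite n3.
pose o l (l3 : (l < 3)%N) := Ordinal (lt3 l l3).
pose i0 := @o 0%N isT; pose i1 := @o 1%N isT; pose i2 := @o 2%N isT.
have [a [aE a_gen]] := kernel_coxeter_gen C_pres theta_x i0.
have xx3 (i j : 'I_n) : (i < j)%N -> (x i * x j) ^+ 3 = 1.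
  by move=> ij; apply: (coxeter_xxk C_pres ij); apply: m3.
have xx := coxeter_xx C_pres; have xV := coxeter_xV C_pres.
have a1 : a i0 = 1 by apply: val_inj; rewrite aE xx.
pose s (t : bool) := if t then a i2 else a i1.
apply: (@euclidean_triangle_virtually_abelian _ s).
- move=> g; have [w <-] := a_gen g; elim: w => [|[i e] w [v IH]]; first by exists [::].
  rewrite [eval_word _ _]/= -IH.
  have: i \in [:: i0; i1; i2].
    by case: i => [[|[|[|l]]] l_n]; rewrite !inE -!(inj_eq val_inj) //=; rewrite n3 in l_n.
  rewrite !inE => /or3P [] /eqP ->.
  + by exists v; rewrite /eval_letter /= a1 invg1 if_same mul1g.
  + by exists ((false, e) :: v).
  + by exists ((true, e) :: v).
- by case; apply: val_inj; rewrite val_kernelX aE; apply: xx3.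
- apply: val_inj; rewrite val_kernelX /= !aE invgM !xV.
  have -> : x i0 * x i1 * (x i2 * x i0) = (x i1 * x i2) ^ x i0.
    by rewrite /conjg xV !mulgA.
  by rewrite -conjXg xx3 // conj1g.
Qed.

End SmallCoxeter.

(** * Case distinction on p, n and the labels *)

Theorem theorem4p3 (p n : nat) (m : 'I_n -> 'I_n -> option nat)
    (C : groupType) (x : 'I_n -> C) (theta : {multiplicative C -> 'Z_2}) :
  prime p -> odd p -> (2 <= n)%N ->
  coxeter_group m x ->
  labels_powers_of p m ->
  (forall i : 'I_n, theta (x i) = Zp1) ->
  ~ virtually_abelian (kernel_group theta) ->
  uncountably_many_groups (fun Q : groupType =>
    [/\ surjects_onto (kernel_group theta) Q,
        infinite_group Q,
        residually_finite Q
      & p_group p Q]).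
Proof.
move=> p_prime p_odd n2 [m_ge2 C_pres] m_pow theta_x nVA.
have labelE (i j : 'I_n) k : (i < j)%N -> m i j = Some k ->
    exists e, k = (p ^ e.+1)%N.
  move=> ij mk; have [[|e] ke] := m_pow _ _ _ ij mk; last by exists e.
  by have := m_ge2 _ _ _ ij mk; rewrite ke.
have label_p (i j : 'I_n) k : (i < j)%N -> m i j = Some k -> (p %| k)%N.
  by move=> ij /(labelE _ _ _ ij) [e ->]; rewrite expnS dvdn_mulr.
have n3 : (3 <= n)%N.
  rewrite ltn_neqAle n2 andbT; apply/eqP => n2'; apply: nVA.
  exact: (rank2_kernel_virtually_abelian C_pres theta_x (esym n2')).
have ord_lt3 l : (l < 3)%N -> (l < n)%N by move=> l3; apply: leq_trans n3.
have [p5|p_le3] := ltnP 3 p.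
  have [Q [s [pQ s_ord ss_ord]]] := cyclic_triangle_stage p_prime p5.
  (* Any distribution onto the three classes works here, as all three relators have exponent p and
     3/p < 1. *)
  pose cls (i : 'I_n) := match val i with
    0 => None | 1 => Some false | _ => Some true end%N.
  apply: (triangle_kernel_quotients C_pres theta_x p_prime pQ s_ord ss_ord (cls := cls)) => //.
  - have p0 : (0 < p%:R :> rat)%R by rewrite ltr0n prime_gt0.
    rewrite expn1 -(ltr_pM2r p0) !mulrDl !mulVf ?gt_eqF // mul1r.
    by rewrite (_ : 1 + 1 + 1 = 3%:R :> rat)%R // ltr_nat.
  - by case=> [[]|]; [exists (Ordinal (@ord_lt3 2%N isT))
      | exists (Ordinal (@ord_lt3 1%N isT)) | exists (Ordinal (ord_lt3 0 isT))].
  - by move=> i j k ij mk _ _ _; rewrite expn1; apply: label_p mk.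
have p3 : p = 3.
  by move: p_prime p_odd p_le3; case: (p) => [|[|[|[|]]]].
subst p.
have [n4|n_le3] := ltnP 3 n.
  exact: (simplex_kernel_quotients C_pres theta_x n4 label_p).
have n_eq3 : n = 3 by apply/eqP; rewrite eqn_leq n_le3.
have [i [j [ij mij]]] : exists i j : 'I_n, (i < j)%N /\ m i j <> Some 3.
  apply: contra_notP nVA => no_ij.
  apply: (euclidean_kernel_virtually_abelian C_pres theta_x n_eq3) => i j ij.
  by apply: contra_notP no_ij => ?; exists i, j.
have [Q [s [pQ s_ord ss_ord]]] := wreath_triangle_stage.
(* The pair whose label is not 3 goes to a and b, so only this label must be infinite or divisible
   by 9; then 1/3 + 1/3 + 1/9 < 1. *)
pose cls l := if l == i then Some false else if l == j then Some true else None.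
have ji : (j == i) = false by rewrite -(inj_eq val_inj) gtn_eqF.
apply: (triangle_kernel_quotients C_pres theta_x p_prime pQ s_ord ss_ord (cls := cls)) => //.
- case=> [[]|]; [exists j | exists i | ]; rewrite /cls ?ji ?eqxx //.
  have [l] : exists l, l \notin [set i; j].
    apply/existsP; rewrite -negb_forall; apply/negP => /forallP ij_all.
    have : (#|'I_n| <= #|[set i; j]|)%N.
      by apply/subset_leq_card/fintype.subsetP => l _; apply: ij_all.
    by rewrite cards2 card_ord leqNgt (leq_trans _ n3) //; case: (i != j).
  by rewrite !inE negb_or => /andP [/negbTE li /negbTE lj]; exists l; rewrite li lj.
- move=> a b k ab mk; rewrite /cls.
  have [ai|ai] := eqVneq a i; last first.
    have [aj|//] := eqVneq a j; have [bi|bi] := eqVneq b i.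
      by rewrite aj bi ltnNge (ltnW ij) in ab.
    by have [bj|//] := eqVneq b j.
  have [bi|bi] := eqVneq b i; first by rewrite ai bi ltnn in ab.
  have [bj _ _ _|//] := eqVneq b j; have [[|e] ke] := labelE _ _ _ ab mk.
    by case: mij; rewrite -ai -bj mk ke.
  by rewrite ke dvdn_exp2l.
Qed.
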